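(* Let $M=\langle W,W^\bot,\preceq,R,V\rangle$ be a $\mathsf{CK}$-model, let $w\in W$, and let $\varphi$ be a well-named constructive $\mu$-formula. Then player $\mathsf{I}$ has a winning strategy for the evaluation game $\mathcal{G}(M,w\models\varphi)$ if and only if $M,w\models\varphi$; and player $\mathsf{II}$ has a winning strategy for $\mathcal{G}(M,w\models\varphi)$ if and only if $M,w\not\models\varphi$.
   Context: Syntax. Fix a set $\mathrm{Prop}$ of proposition symbols and a set $\mathrm{Var}$ of variable symbols. Constructive $\mu$-formulas: $\varphi ::= P \mid X \mid \bot \mid \top \mid \neg\varphi \mid \varphi\land\varphi \mid \varphi\lor\varphi \mid \varphi\to\varphi \mid \Box\varphi \mid \Diamond\varphi \mid \mu X.\varphi \mid \nu X.\varphi$ ($P\in\mathrm{Prop}$, $X\in\mathrm{Var}$), where $\mu X.\varphi$ and $\nu X.\varphi$ are formed only when $X$ is positive in $\varphi$. Positivity/negativity is defined inductively: $X$ is positive and negative in $P$, $\bot$ (and $\top$) and in any variable $Y\neq X$; $X$ is positive in $X$; if $X$ is positive (negative) in $\varphi$ then it is negative (positive) in $\neg\varphi$; if $X$ is positive (negative) in $\varphi$ and $\psi$ then it is positive (negative) in $\varphi\land\psi,\varphi\lor\psi,\Box\varphi,\Diamond\varphi$; if $X$ is negative (positive) in $\varphi$ and positive (negative) in $\psi$ then it is positive (negative) in $\varphi\to\psi$; $X$ is positive and negative in $\mu X.\varphi$ and $\nu X.\varphi$. Free occurrences of variables are treated as proposition symbols. $\eta$ denotes $\mu$ or $\nu$.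 A formula is guarded if for every subformula $\eta X.\psi$, every occurrence of $X$ in $\psi$ is in the scope of a modality $\Box$ or $\Diamond$; it is well-bounded if every variable occurring bound occurs only once and there is only one operator $\eta X$ for it; it is well-named if guarded and well-bounded. For well-named $\varphi$ and $\eta X.\psi\in\mathrm{Sub}(\varphi)$ write $\psi_X$ for the body $\psi$ bound by $\eta X$. Models. A $\mathsf{CK}$-model is $M=\langle W,W^\bot,\preceq,R,V\rangle$ with $W$ a set, $W^\bot\subseteq W$ (fallible worlds), $\preceq$ a preorder on $W$, $R$ a binary relation on $W$, $V:\mathrm{Prop}\to\mathcal P(W)$, such that $w\preceq v$ and $w\in V(P)$ imply $v\in V(P)$; $W^\bot\subseteq V(P)$ for all $P$; and if $w\in W^\bot$ and ($w\preceq v$ or $wRv$) then $v\in W^\bot$. Semantics $\|\cdot\|^M$: $\|P\|=V(P)$; $\|\bot\|=W^\bot$; $\|\top\|=W$; $\land,\lor$ are intersection and union; $w\in\|\varphi\to\psi\|$ iff for all $v\succeq w$, $v\in\|\varphi\|$ implies $v\in\|\psi\|$; $w\in\|\neg\varphi\|$ iff for all $v\succeq w$, $v\notin\|\varphi\|$; $w\in\|\Box\varphi\|$ iff for all $v,u$ with $w\preceq v R u$, $u\in\|\varphi\|$; $w\in\|\Diamond\varphi\|$ iff for all $v\succeq w$ there is $u$ with $vRu$ and $u\in\|\varphi\|$; $\|\mu X.\varphi\|$ and $\|\nu X.\varphi\|$ are the least and greatest fixed points of the monotone operator $A\mapsto\|\varphi\|^{M[X\mapsto A]}$, where $M[X\mapsto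 A]$ sets $V(X):=A$. $M,w\models\varphi$ means $w\in\|\varphi\|^M$. Evaluation game $\mathcal{G}(M,w\models\varphi)$. Two players $\mathsf{I},\mathsf{II}$, each holding one of the roles Verifier $\mathsf{V}$ and Refuter $\mathsf{R}$ (always different roles); $\bar{\mathsf Q}$ is the role dual to $\mathsf Q$. Main positions $\langle v,\psi,\mathsf Q\rangle$ ($v\in W$, $\psi\in\mathrm{Sub}(\varphi)$, $\mathsf Q$ the role of $\mathsf I$); auxiliary positions $\langle\langle v\rangle,\psi,\mathsf Q\rangle$ ($\Diamond\psi\in\mathrm{Sub}(\varphi)$), $\langle[v],\psi,\mathsf Q\rangle$ ($\Box\psi\in\mathrm{Sub}(\varphi)$), $\langle v,\theta?\theta',\mathsf Q\rangle$ ($\theta\to\theta'\in\mathrm{Sub}(\varphi)$). The game starts at $\langle w,\varphi,\mathsf V\rangle$. Moves (owner chooses): positions $\langle v,\psi,\mathsf Q\rangle$ with $v\in W^\bot$ are owned by the Refuter and have no moves. For $v\notin W^\bot$: $\langle v,P,\mathsf Q\rangle$ has no moves and is owned by the Refuter if $v\in V(P)$, by the Verifier otherwise; at $\langle v,\psi\lor\theta,\mathsf Q\rangle$ the Verifier moves to $\langle v,\psi,\mathsf Q\rangle$ or $\langle v,\theta,\mathsf Q\rangle$; at $\langle v,\psi\land\theta,\mathsf Q\rangle$ the Refuter does so; at $\langle v,\neg\psi,\mathsf Q\rangle$ the Refuter moves to some $\langle u,\psi,\bar{\mathsf Q}\rangle$ with $v\preceq u$; at $\langle v,\psi\to\theta,\mathsf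 Q\rangle$ the Refuter moves to some $\langle u,\psi?\theta,\mathsf Q\rangle$ with $v\preceq u$, and at $\langle u,\psi?\theta,\mathsf Q\rangle$ the Verifier moves to $\langle u,\psi,\bar{\mathsf Q}\rangle$ or $\langle u,\theta,\mathsf Q\rangle$; at $\langle v,\Diamond\psi,\mathsf Q\rangle$ the Refuter moves to some $\langle\langle u\rangle,\psi,\mathsf Q\rangle$ with $v\preceq u$, then the Verifier moves to some $\langle u',\psi,\mathsf Q\rangle$ with $uRu'$; at $\langle v,\Box\psi,\mathsf Q\rangle$ the Refuter moves to some $\langle[u],\psi,\mathsf Q\rangle$ with $v\preceq u$, then the Refuter moves to some $\langle u',\psi,\mathsf Q\rangle$ with $uRu'$; from $\langle v,\eta X.\psi_X,\mathsf Q\rangle$ the only move is to $\langle v,\psi_X,\mathsf Q\rangle$, and from $\langle v,X,\mathsf Q\rangle$ the only move is to $\langle v,\eta X.\psi_X,\mathsf Q\rangle$ (a regeneration of $\eta X.\psi_X$). A run is a maximal sequence of positions following these rules from the initial position. The role $\mathsf Q$ in positions $\langle v,\eta X.\psi_X,\mathsf Q\rangle$ reachable from the start is the same for all of them; $\eta X.\psi_X$ is owned by $\mathsf I$ if this role is $\mathsf V$ and $\eta=\nu$, or it is $\mathsf R$ and $\eta=\mu$; otherwise it is owned by $\mathsf{II}$. Winning: in a finite run the owner of the last position (which has no moves) loses; in an infinite run, let $\eta X.\psi_X$ be the outermost fixed-point formula regenerated infinitely often (every other infinitely often regenerated one is its subformula); $\mathsf I$ wins iff $\mathsf I$ owns it.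 A (positional) strategy for a player maps each position owned by that player to an available move; it is winning if that player wins every run in which the player follows it.
   Formalization: Fallible worlds are taken to satisfy every formula (W^⊥ is added to each clause of the semantics), since with the literal clauses for ¬, ◇ and fixed points the claim fails at fallible worlds; when W^⊥ is empty nothing changes. Equality of variable symbols is decidable. *)

(* Defs.v *)
From mathcomp Require Import all_boot.
From mathcomp Require Import boolp classical_sets.

Set Implicit Arguments.
Unset Strict Implicit.
Unset Printing Implicit Defensive.

Local Open Scope classical_set_scope.

Section Syntax.
Context (PS : Type) (VS : eqType).

Variant fixpoint_op := Mu | Nu.

(* Raw syntax: the side condition that X is positive in the body of each
   fixed point is the separate predicate [well_formed]. *)
Inductive formula :=
  | FProp of PS
  | FVar of VS
  | FBot
  | FTop
  | FNeg of formula
  | FAnd of formula & formula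
  | FOr of formula & formula
  | FImp of formula & formula
  | FBox of formula
  | FDia of formula
  | FFix of fixpoint_op & VS & formula.

(* [polar true X phi]: X is positive in phi; [polar false X phi]: X is negative
   in phi. *)
Fixpoint polar (b : bool) (X : VS) (phi : formula) : bool :=
  match phi with
  | FProp _ | FBot | FTop => true
  | FVar Y => (Y == X) ==> b
  | FNeg p => polar (~~ b) X p
  | FAnd p q | FOr p q => polar b X p && polar b X q
  | FImp p q => polar (~~ b) X p && polar b X q
  | FBox p | FDia p => polar b X p
  | FFix _ Y p => (Y == X) || polar b X p
  end.

Definition positive := polar true.

(* Reflexive: every formula is a subformula of itself. *)
Fixpoint subformula (psi phi : formula) : Prop :=
  psi = phi \/
  match phi with
  | FProp _ | FVar _ | FBot | FTop => False
  | FNeg p | FBox p | FDia p | FFix _ _ p => subformula psi p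
  | FAnd p q | FOr p q | FImp p q => subformula psi p \/ subformula psi q
  end.

Definition well_formed (phi : formula) : Prop :=
  forall eta X psi, subformula (FFix eta X psi) phi -> positive X psi.

Fixpoint guarded_in (X : VS) (phi : formula) : bool :=
  match phi with
  | FProp _ | FBot | FTop => true
  | FVar Y => Y != X
  | FNeg p | FFix _ _ p => guarded_in X p
  | FAnd p q | FOr p q | FImp p q => guarded_in X p && guarded_in X q
  | FBox _ | FDia _ => true
  end.

Definition guarded (phi : formula) : Prop :=
  forall eta X psi, subformula (FFix eta X psi) phi -> guarded_in X psi.

(* Number of occurrences of X as a formula, free or bound; the X of an operator
   [FFix eta X] is not counted here but in [binders]. *)
Fixpoint occurrences (X : VS) (phi : formula) : nat :=
  match phi with
  | FProp _ | FBot | FTop => 0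
  | FVar Y => Y == X
  | FNeg p | FBox p | FDia p | FFix _ _ p => occurrences X p
  | FAnd p q | FOr p q | FImp p q => occurrences X p + occurrences X q
  end.

Fixpoint binders (X : VS) (phi : formula) : nat :=
  match phi with
  | FProp _ | FVar _ | FBot | FTop => 0
  | FNeg p | FBox p | FDia p => binders X p
  | FAnd p q | FOr p q | FImp p q => binders X p + binders X q
  | FFix _ Y p => (Y == X) + binders X p
  end.

(* [occurrences X phi <= 1] rather than [= 1]: vacuous fixed points, in which
   the bound variable does not occur at all, are allowed. *)
Definition well_bounded (phi : formula) : Prop :=
  forall X, 0 < binders X phi -> binders X phi = 1 /\ occurrences X phi <= 1.

Definition well_named (phi : formula) : Prop := guarded phi /\ well_bounded phi.

Fixpoint free (X : VS) (phi : formula) : bool :=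
  match phi with
  | FProp _ | FBot | FTop => false
  | FVar Y => Y == X
  | FNeg p | FBox p | FDia p => free X p
  | FAnd p q | FOr p q | FImp p q => free X p || free X q
  | FFix _ Y p => (Y != X) && free X p
  end.

End Syntax.

Arguments FProp {PS VS}.
Arguments FVar {PS VS}.
Arguments FBot {PS VS}.
Arguments FTop {PS VS}.

(* Free variables are treated as proposition symbols, so valuations are defined
   on both kinds of symbols. *)
Record ckModel (PS : Type) (VS : eqType) := CKModel {
  world :> Type;
  fallible : set world;
  prec : world -> world -> Prop;
  acc : world -> world -> Prop;
  valn : PS + VS -> set world;
  prec_refl : forall w, prec w w;
  prec_trans : forall w v u, prec w v -> prec v u -> prec w u;
  valn_prec : forall s w v, prec w v -> valn s w -> valn s v;
  fallible_valn : forall s, fallible `<=` valn s;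
  fallible_prec : forall w v, fallible w -> prec w v -> fallible v;
  fallible_acc : forall w v, fallible w -> acc w v -> fallible v
}.

Section Fixpoints.
Context (W : Type).

Definition lfp (F : set W -> set W) : set W :=
  [set w | forall A, F A `<=` A -> A w].

Definition gfp (F : set W -> set W) : set W :=
  [set w | exists2 A, A `<=` F A & A w].

Definition monotone (F : set W -> set W) : Prop :=
  forall A B, A `<=` B -> F A `<=` F B.

Definition is_least_fixpoint (F : set W -> set W) (A : set W) : Prop :=
  F A = A /\ forall B, F B = B -> A `<=` B.

Definition is_greatest_fixpoint (F : set W -> set W) (A : set W) : Prop :=
  F A = A /\ forall B, F B = B -> B `<=` A.

Lemma lfpP F : monotone F -> is_least_fixpoint F (lfp F).
Proof.
move=> mF; have le : F (lfp F) `<=` lfp F.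
  move=> w Fw A FA; apply: (FA); apply: mF Fw => v; exact.
split; first by apply/seteqP; split=> // w; apply; apply: mF.
by move=> B FB w; apply; rewrite FB.
Qed.

Lemma gfpP F : monotone F -> is_greatest_fixpoint F (gfp F).
Proof.
move=> mF; have le : gfp F `<=` F (gfp F).
  by move=> w [A AF /AF]; apply: mF => v Av; exists A.
split; first by apply/seteqP; split=> // w Fw; exists (F (gfp F)) => //; apply: mF.
by move=> B FB w Bw; exists B => //; rewrite FB.
Qed.

End Fixpoints.

Section Semantics.
Context (PS : Type) (VS : eqType) (M : ckModel PS VS).

Definition update (V : PS + VS -> set M) (X : VS) (A : set M)
    : PS + VS -> set M :=
  fun s => if s is inr Y then if Y == X then A else V s else V s.

(* Fallible worlds force every formula, as in the evaluation game, where the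
   Verifier wins each main position at a fallible world. The clauses for
   negation and diamond do not give this by themselves: a fallible w satisfies
   P, hence would not satisfy ~P, and it need not have any acc-successor. At
   worlds that are not fallible the first disjunct is void. *)
Fixpoint sem (V : PS + VS -> set M) (phi : formula PS VS) : set M :=
  @fallible _ _ M `|`
  match phi with
  | FProp P => V (inl P)
  | FVar X => V (inr X)
  | FBot => @fallible _ _ M
  | FTop => setT
  | FNeg p => [set w | forall v, prec w v -> ~ sem V p v]
  | FAnd p q => sem V p `&` sem V q
  | FOr p q => sem V p `|` sem V q
  | FImp p q => [set w | forall v, prec w v -> sem V p v -> sem V q v]
  | FBox p => [set w | forall v u, prec w v -> acc v u -> sem V p u]
  | FDia p => [set w | forall v, prec w v -> exists2 u, acc v u & sem V p u]
  | FFix Mu X p => lfp (fun A => sem (update V X A) p)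
  | FFix Nu X p => gfp (fun A => sem (update V X A) p)
  end.

Definition satisfies (w : M) (phi : formula PS VS) : Prop :=
  sem (@valn _ _ M) phi w.

Lemma sem_fallible V phi : @fallible _ _ M `<=` sem V phi.
Proof. by case: phi => *; left. Qed.

Lemma sem_polar phi b X V1 V2 : polar b X phi ->
    (forall s, s <> inr X -> V1 s = V2 s) -> V1 (inr X) `<=` V2 (inr X) ->
  if b then sem V1 phi `<=` sem V2 phi else sem V2 phi `<=` sem V1 phi.
Proof.
elim: phi b V1 V2 => [P|Y|||p IHp|p IHp q IHq|p IHp q IHq|p IHp q IHq
  |p IHp|p IHp|eta Y p IHp] b V1 V2 /=.
- by move=> _ e _; rewrite e //; case: b.
- case: (eqVneq Y X) => [->|nYX] /= pb e le12; last first.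
    have -> : V1 (inr Y) = V2 (inr Y) by apply: e => -[] /eqP; apply/negP.
    by case: b {pb}.
  by rewrite pb; exact: setUS.
- by move=> _ _ _; case: b.
- by move=> _ _ _; case: b.
- move=> pol e le12; have := IHp _ _ _ pol e le12.
  by case: b {pol} => /= H w [fw|Hw]; [left|right=> v /Hw nv /H|left|right=> v /Hw nv /H].
- move=> /andP[/IHp{}IHp /IHq{}IHq] e le12; have := IHp _ _ e le12.
  have := IHq _ _ e le12.
  by case: b {IHp IHq} => Hq Hp; apply: setUS; exact: setISS.
- move=> /andP[/IHp{}IHp /IHq{}IHq] e le12; have := IHp _ _ e le12.
  have := IHq _ _ e le12.
  by case: b {IHp IHq} => Hq Hp; apply: setUS; exact: setUSS.
- move=> /andP[/IHp{}IHp /IHq{}IHq] e le12; have := IHp _ _ e le12.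
  have := IHq _ _ e le12.
  by case: b {IHp IHq} => /= Hq Hp; apply: setUS => w Hw v wv /Hp /(Hw v wv) /Hq.
- move=> pol e le12; have := IHp _ _ _ pol e le12.
  by case: b {pol} => H; apply: setUS => w Hw v u wv vu; apply/H/(Hw v u wv vu).
- move=> pol e le12; have := IHp _ _ _ pol e le12.
  by case: b {pol} => H; apply: setUS => w Hw v /Hw[u vu /H]; exists u.
- case: (eqVneq Y X) => [->|nYX] /= pol e le12.
    have -> : (fun A => sem (update V1 X A) p) = (fun A => sem (update V2 X A) p).
      apply/funext => A; congr sem; apply/funext => -[Q|Z] /=; first exact: e.
      by case: eqVneq => // nZX; apply: e => -[] /eqP; apply/negP.
    by case: b {pol}.
  have H A : if b then sem (update V1 Y A) p `<=` sem (update V2 Y A) p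
             else sem (update V2 Y A) p `<=` sem (update V1 Y A) p.
    apply: IHp pol _ _ => [[Q|Z] /= ne|/=]; first exact: e.
      by case: eqVneq => // _; apply: e.
    by rewrite eq_sym (negbTE nYX).
  by case: b {pol} H => H; apply: setUS; case: eta => w;
     [move=> Hw A AF; apply: Hw => v /H /AF
     |move=> [A AF Aw]; exists A => // v /AF /H
     |move=> Hw A AF; apply: Hw => v /H /AF
     |move=> [A AF Aw]; exists A => // v /AF /H].
Qed.

Lemma sem_monotone V X phi : positive X phi ->
  monotone (fun A => sem (update V X A) phi).
Proof.
move=> pos A B AB; apply: (@sem_polar phi true X) pos _ _ => [[Q|Y]|] //=.
  by move=> ne; case: eqVneq => // e; case: ne; rewrite e.
by rewrite eqxx.
Qed.

Lemma sem_mu V X phi : positive X phi ->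
  is_least_fixpoint (fun A => sem (update V X A) phi) (sem V (FFix Mu X phi)).
Proof.
move=> pos; have lP := lfpP (@sem_monotone V X phi pos).
by rewrite /= ((setUidPr _ _).2 _) // -lP.1; exact: sem_fallible.
Qed.

Lemma sem_nu V X phi : positive X phi ->
  is_greatest_fixpoint (fun A => sem (update V X A) phi) (sem V (FFix Nu X phi)).
Proof.
move=> pos; have gP := gfpP (@sem_monotone V X phi pos).
by rewrite /= ((setUidPr _ _).2 _) // -gP.1; exact: sem_fallible.
Qed.

End Semantics.

Variant player := PlayerI | PlayerII.
Variant role := Verifier | Refuter.

Definition dual (Q : role) : role :=
  match Q with Verifier => Refuter | Refuter => Verifier end.

Section Game.
Context (PS : Type) (VS : eqType) (M : ckModel PS VS).
Context (w0 : M) (phi : formula PS VS).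

(* The role component is the role of player I. *)
Inductive position :=
  | PMain of M & formula PS VS & role
  | PDia of M & formula PS VS & role
  | PBox of M & formula PS VS & role
  | PImp of M & formula PS VS & formula PS VS & role.

Definition initial : position := PMain w0 phi Verifier.

Definition is_position (p : position) : Prop :=
  match p with
  | PMain _ psi _ => subformula psi phi
  | PDia _ psi _ => subformula (FDia psi) phi
  | PBox _ psi _ => subformula (FBox psi) phi
  | PImp _ psi theta _ => subformula (FImp psi theta) phi
  end.

Definition role_of (pl : player) (p : position) : role :=
  match p with
  | PMain _ _ Q | PDia _ _ Q | PBox _ _ Q | PImp _ _ _ Q =>
    match pl with PlayerI => Q | PlayerII => dual Q end
  end.

(* Positions at a fixed-point formula or at a bound variable have exactly one
   move, so which role owns them is immaterial. *)
Definition owner_role (p : position) : role :=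
  match p with
  | PMain v psi _ =>
    if `[< fallible v >] then Refuter else
    match psi with
    | FProp P => if `[< valn (inl P) v >] then Refuter else Verifier
    | FVar X => if free X phi && `[< valn (inr X) v >] then Refuter else Verifier
    | FBot => Verifier
    | FTop => Refuter
    | FOr _ _ => Verifier
    | FAnd _ _ | FNeg _ | FImp _ _ | FDia _ | FBox _ => Refuter
    | FFix _ _ _ => Verifier
    end
  | PDia _ _ _ => Verifier
  | PBox _ _ _ => Refuter
  | PImp _ _ _ _ => Verifier
  end.

Definition owns (pl : player) (p : position) : Prop :=
  owner_role p = role_of pl p.

Definition moves_main (v : M) (psi : formula PS VS) (Q : role) : set position :=
  match psi with
  | FProp _ | FBot | FTop => set0
  | FVar X => [set q | ~~ free X phi /\ exists eta theta,
      subformula (FFix eta X theta) phi /\ q = PMain v (FFix eta X theta) Q]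
  | FNeg p => [set q | exists2 u, prec v u & q = PMain u p (dual Q)]
  | FAnd p p' | FOr p p' => [set PMain v p Q; PMain v p' Q]
  | FImp p p' => [set q | exists2 u, prec v u & q = PImp u p p' Q]
  | FBox p => [set q | exists2 u, prec v u & q = PBox u p Q]
  | FDia p => [set q | exists2 u, prec v u & q = PDia u p Q]
  | FFix _ _ p => [set PMain v p Q]
  end.

Definition moves (p : position) : set position :=
  match p with
  | PMain v psi Q => [set q | ~ fallible v /\ moves_main v psi Q q]
  | PDia u psi Q | PBox u psi Q =>
      [set q | exists2 u', acc u u' & q = PMain u' psi Q]
  | PImp u psi theta Q => [set PMain u psi (dual Q); PMain u theta Q]
  end.

Inductive reachable : position -> Prop :=
  | reachable_initial : reachable initial
  | reachable_move p q : reachable p -> moves p q -> reachable q.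

Definition owns_fixpoint_I (theta : formula PS VS) : Prop :=
  exists eta X psi v Q,
    [/\ theta = FFix eta X psi, reachable (PMain v theta Q)
      & Q = match eta with Nu => Verifier | Mu => Refuter end].

Definition owns_fixpoint (pl : player) (theta : formula PS VS) : Prop :=
  match pl with
  | PlayerI => owns_fixpoint_I theta
  | PlayerII => ~ owns_fixpoint_I theta
  end.

(* A finite run is r 0, ..., r n; the values of r beyond n are irrelevant. *)
Definition finite_run (r : nat -> position) (n : nat) : Prop :=
  [/\ r 0 = initial, forall i, i < n -> moves (r i) (r i.+1)
    & moves (r n) = set0].

Definition infinite_run (r : nat -> position) : Prop :=
  r 0 = initial /\ forall i, moves (r i) (r i.+1).

Definition regenerates_at (r : nat -> position) (theta : formula PS VS)
    (i : nat) : Prop :=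
  exists v X Q, r i = PMain v (FVar X) Q /\ r i.+1 = PMain v theta Q.

Definition regenerates_infinitely_often (r : nat -> position)
    (theta : formula PS VS) : Prop :=
  forall n, exists2 i, n <= i & regenerates_at r theta i.

Definition outermost_regenerated (r : nat -> position)
    (theta : formula PS VS) : Prop :=
  regenerates_infinitely_often r theta /\
  forall theta', regenerates_infinitely_often r theta' -> subformula theta' theta.

Definition wins_finite (pl : player) (r : nat -> position) (n : nat) : Prop :=
  ~ owns pl (r n).

Definition wins_infinite (pl : player) (r : nat -> position) : Prop :=
  exists2 theta, outermost_regenerated r theta & owns_fixpoint pl theta.

(* Only the values of [sigma] at positions owned by [pl] that have a move
   matter; elsewhere its value is arbitrary. *)
Definition is_strategy (pl : player) (sigma : position -> position) : Prop :=
  forall p, is_position p -> owns pl p -> moves p !=set0 -> moves p (sigma p).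

Definition follows_at (pl : player) (sigma : position -> position)
    (r : nat -> position) (i : nat) : Prop :=
  owns pl (r i) -> r i.+1 = sigma (r i).

Definition is_winning (pl : player) (sigma : position -> position) : Prop :=
  (forall r n, finite_run r n -> (forall i, i < n -> follows_at pl sigma r i) ->
     wins_finite pl r n) /\
  (forall r, infinite_run r -> (forall i, follows_at pl sigma r i) ->
     wins_infinite pl r).

Definition has_winning_strategy (pl : player) : Prop :=
  exists2 sigma, is_strategy pl sigma & is_winning pl sigma.

End Game.

(* Main.v *)
Require Import Defs.
From mathcomp Require Import all_boot.
From mathcomp Require Import boolp classical_sets.
From mathcomp Require Import zify.

Set Implicit Arguments.
Unset Strict Implicit.
Unset Printing Implicit Defensive.

Local Open Scope classical_set_scope.

(* By induction on the subformulas psi of phi, and for every valuation of the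
   free variables of psi, each player has a positional strategy on a set of
   positions inside psi that contains all positions at psi true for that player,
   keeps the play in this set until a free variable of psi is reached, where the
   value then favours the player, and wins the infinite plays that stay inside.
   For a fixed point owned by the player it suffices to evaluate the variable by
   the fixed point itself: a play regenerating it infinitely often is won.
   Otherwise the player follows, at each position, the strategy for the least
   approximant of the fixed point that works there; this approximant never
   increases along a play and strictly decreases at each regeneration, so it
   stabilizes. Finally the two players cannot both have winning strategies. *)

(** * Signed occurrences of subformulas, and uniqueness of binders *)

Section Occurrences.
Context (PS : Type) (VS : eqType).
Implicit Types (chi psi theta p q : formula PS VS) (b c d : bool) (X : VS).

(* [occ b chi psi]: chi has an occurrence in psi under an even ([b = true]) or
   odd ([b = false]) number of role switches. *)
Fixpoint occ b chi psi : Prop :=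
  (b /\ chi = psi) \/
  match psi with
  | FProp _ | FVar _ | FBot | FTop => False
  | FNeg p => occ (~~ b) chi p
  | FBox p | FDia p | FFix _ _ p => occ b chi p
  | FAnd p q | FOr p q => occ b chi p \/ occ b chi q
  | FImp p q => occ (~~ b) chi p \/ occ b chi q
  end.

Lemma occ_refl chi : occ true chi chi.
Proof. by case: chi; left. Qed.

Lemma occ_subformula b chi psi : occ b chi psi -> subformula chi psi.
Proof.
elim: psi b => [P|Y|||p IHp|p IHp q IHq|p IHp q IHq|p IHp q IHq
  |p IHp|p IHp|e Y p IHp] b /= [[_ ->]|H]; by [left|right; intuition eauto].
Qed.

Lemma subformula_occ chi psi : subformula chi psi -> exists b, occ b chi psi.
Proof.
elim: psi => [P|Y|||p IHp|p IHp q IHq|p IHp q IHq|p IHp q IHq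
  |p IHp|p IHp|e Y p IHp] /= [->|] //; try by exists true; left.
- by move=> /IHp[b H]; exists (~~ b); right; rewrite negbK.
- by move=> [/IHp|/IHq][b H]; exists b; right; [left|right].
- by move=> [/IHp|/IHq][b H]; exists b; right; [left|right].
- move=> [/IHp|/IHq][b H]; last by exists b; right; right.
  by exists (~~ b); right; left; rewrite negbK.
- by move=> /IHp[b H]; exists b; right.
- by move=> /IHp[b H]; exists b; right.
- by move=> /IHp[b H]; exists b; right.
Qed.

(** Here [b == c] is the product of the two signs: switches along consecutive paths add up modulo
    two. *)
Lemma occ_trans b c chi psi theta :
  occ b chi psi -> occ c psi theta -> occ (b == c) chi theta.
Proof.
have nb d : ~~ (b == d) = (b == ~~ d) by case: b d => -[].
move=> Hb; elim: theta c => [P|Y|||p IHp|p IHp q IHq|p IHp q IHq|p IHp q IHq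
  |p IHp|p IHp|e Y p IHp] c; case=> [[ct Epsi]|Hc];
  try by rewrite ct eqb_id -Epsi.
all: by right; rewrite ?nb; intuition eauto.
Qed.

Lemma subformula_trans chi psi theta :
  subformula chi psi -> subformula psi theta -> subformula chi theta.
Proof.
move=> /subformula_occ[b Hb] /subformula_occ[c Hc].
exact: occ_subformula (occ_trans Hb Hc).
Qed.

Fixpoint fsize psi : nat :=
  match psi with
  | FProp _ | FVar _ | FBot | FTop => 0
  | FNeg p | FBox p | FDia p | FFix _ _ p => (fsize p).+1
  | FAnd p q | FOr p q | FImp p q => (fsize p + fsize q).+1
  end.

Lemma subformula_fsize chi psi : subformula chi psi ->
  chi = psi \/ fsize chi < fsize psi.
Proof.
elim: psi => [P|Y|||p IHp|p IHp q IHq|p IHp q IHq|p IHp q IHq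
  |p IHp|p IHp|e Y p IHp] /= [->|] //=; try by left.
all: try by move=> /IHp[->|]; right; lia.
all: by move=> [/IHp|/IHq] [->|]; right; lia.
Qed.

Lemma subformula_antisym chi psi :
  subformula chi psi -> subformula psi chi -> chi = psi.
Proof. by move=> /subformula_fsize[//|lt1] /subformula_fsize[//|]; lia. Qed.

Lemma subformula_binders X chi psi : subformula chi psi ->
  binders X chi <= binders X psi.
Proof.
elim: psi => [P|Y|||p IHp|p IHp q IHq|p IHp q IHq|p IHp q IHq
  |p IHp|p IHp|e Y p IHp] /= [->|] //=.
all: try by move=> /IHp.
all: try by move=> [/IHp|/IHq] ?; lia.
by move=> /IHp ?; lia.
Qed.

Lemma subformula_occurrences X chi psi : subformula chi psi ->
  occurrences X chi <= occurrences X psi.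
Proof.
elim: psi => [P|Y|||p IHp|p IHp q IHq|p IHp q IHq|p IHp q IHq
  |p IHp|p IHp|e Y p IHp] /= [->|] //=.
all: try by move=> /IHp.
all: by move=> [/IHp|/IHq] ?; lia.
Qed.

Lemma free_occurrences X psi : free X psi -> 0 < occurrences X psi.
Proof.
elim: psi => //= [Y -> //|p IHp q IHq|p IHp q IHq|p IHp q IHq|e Y p IHp].
all: try by move=> /orP[/IHp|/IHq]; lia.
by move=> /andP[_ /IHp].
Qed.

(** A free occurrence of X in [psi] lies outside the scope of the binder, so it is not among the
    occurrences counted in [p]. *)
Lemma fix_free_occurrences e X p psi : subformula (FFix e X p) psi ->
  occurrences X p + free X psi <= occurrences X psi.
Proof.
have fo q : free X q <= occurrences X q.
  by have := @free_occurrences X q; case: free => // /(_ isT).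
elim: psi => [P|Y|||q IHq|q IHq r IHr|q IHq r IHr|q IHq r IHr
  |q IHq|q IHq|e' Y q IHq] /= [] //.
all: try by move=> /IHq.
all: try by move=> [/IHq|/IHr]; have := fo q; have := fo r; case: free; case: free => /=; lia.
- by move=> [_ <- <-]; rewrite eqxx /= addn0.
- by move=> /IHq; case: (Y != X) => /=; lia.
Qed.

(** Binders of X in two different operands, or one nested inside the other, would both be counted by
    [binders X psi]. So the two paths agree, and with them the parities. *)
Lemma occ_fix_unique b b' e e' X p p' psi : binders X psi <= 1 ->
  occ b (FFix e X p) psi -> occ b' (FFix e' X p') psi ->
  [/\ b = b', e = e' & p = p'].
Proof.
have B c f r q : occ c (FFix f X r) q -> 0 < binders X q.
  by move=> /occ_subformula /(subformula_binders X) /=; rewrite eqxx; lia.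
elim: psi b b' => [P|Y|||q IHq|q IHq r IHr|q IHq r IHr|q IHq r IHr
  |q IHq|q IHq|d Y q IHq] b b' /= bd.
all: try by move=> [[]|].
all: try by move=> [[_ //]|H] [[_ //]|H']; exact: IHq bd H H'.
- move=> [[_ //]|H] [[_ //]|H']; case: (IHq _ _ bd H H') => nb -> ->.
  by split=> //; apply: negb_inj.
- by move=> [[_ //]|[H|H]] [[_ //]|[H'|H']]; (have := B _ _ _ _ H; have := B _ _ _ _ H' => ? ?;
    try lia); [apply: IHq H H' | apply: IHr H H']; lia.
- by move=> [[_ //]|[H|H]] [[_ //]|[H'|H']]; (have := B _ _ _ _ H; have := B _ _ _ _ H' => ? ?;
    try lia); [apply: IHq H H' | apply: IHr H H']; lia.
- move=> [[_ //]|[H|H]] [[_ //]|[H'|H']]; (have := B _ _ _ _ H; have := B _ _ _ _ H' => ? ?;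
    try lia); [have [| nb -> ->] := IHq _ _ _ H H' | apply: IHr H H']; try lia.
  by split=> //; apply: negb_inj.
- move=> [[bt [-> XY ->]]|H] [[bt' [-> XY' ->]]|H'].
  + by split=> //; case: b b' bt bt' => -[].
  + by move: bd; rewrite XY eqxx -XY; have := B _ _ _ _ H'; lia.
  + by move: bd; rewrite XY' eqxx -XY'; have := B _ _ _ _ H; lia.
  + by apply: IHq H H'; lia.
Qed.

(** The binder is the first operator for X met on the path down to the occurrence; [c] is the parity
    of the path to it, and [b == c] that of the remaining path. *)
Lemma bound_occ b X psi : occ b (FVar X) psi -> ~~ free X psi ->
  exists e p c, occ c (FFix e X p) psi /\ occ (b == c) (FVar X) p.
Proof.
elim: psi b => [P|Y|||q IHq|q IHq r IHr|q IHq r IHr|q IHq r IHr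
  |q IHq|q IHq|d Y q IHq] b /=.
all: try by move=> [[]|].
- by move=> [[_ [->]]|//]; rewrite eqxx.
- move=> [[]//|H] /(IHq _ H)[e [p [c [H1 H2]]]]; exists e, p, (~~ c).
  by rewrite negbK; split; [right|case: b c H2 {H H1} => -[]].
- move=> [[]//|H]; rewrite negb_or => /andP[nq nr].
  by case: H => H; [have := IHq _ H nq|have := IHr _ H nr];
    move=> [e [p [c [H1 H2]]]]; exists e, p, c;
    split=> //; right; [left|right].
- move=> [[]//|H]; rewrite negb_or => /andP[nq nr].
  by case: H => H; [have := IHq _ H nq|have := IHr _ H nr];
    move=> [e [p [c [H1 H2]]]]; exists e, p, c;
    split=> //; right; [left|right].
- move=> [[]//|H]; rewrite negb_or => /andP[nq nr].
  case: H => H; [have := IHq _ H nq|have := IHr _ H nr];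
    move=> [e [p [c [H1 H2]]]]; last first.
    by exists e, p, c; split=> //; right; right.
  exists e, p, (~~ c); rewrite negbK; split; first by right; left.
  by case: b c H2 {H H1} => -[].
- by move=> [[]//|H] /(IHq _ H)[e [p [c [H1 H2]]]]; exists e, p, c; split=> //; right.
- by move=> [[]//|H] /(IHq _ H)[e [p [c [H1 H2]]]]; exists e, p, c; split=> //; right.
- move=> [[]//|H]; case: eqVneq => [YX|_] /= nf.
    by exists d, q, true; rewrite eqb_id; split=> //; left; rewrite YX.
  have [e [p [c [H1 H2]]]] := IHq _ H nf.
  by exists e, p, c; split=> //; right.
Qed.

(** Polarity follows the same sign changes as [occ], except at an operator rebinding X, which the
    last hypothesis excludes. *)
Lemma polar_occ b d X p : polar d X p -> occ b (FVar X) p -> binders X p = 0 ->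
  b = d.
Proof.
elim: p b d => [P|Y|||q IHq|q IHq r IHr|q IHq r IHr|q IHq r IHr
  |q IHq|q IHq|e Y q IHq] b d /=.
all: try by move=> _ [[]|].
- by move=> pd [[-> [XY]]|//] _; move: pd; rewrite XY eqxx /= => ->.
- by move=> pq [[]//|H] /(IHq _ _ pq H) /negb_inj.
- by move=> /andP[pq pr] [[]//|[H|H]] bd; [apply: IHq H _|apply: IHr H _] => //; lia.
- by move=> /andP[pq pr] [[]//|[H|H]] bd; [apply: IHq H _|apply: IHr H _] => //; lia.
- move=> /andP[pq pr] [[]//|[H|H]] bd; [apply: negb_inj; apply: IHq H _|apply: IHr H _] => //; lia.
- by move=> pq [[]//|H] /(IHq _ _ pq H).
- by move=> pq [[]//|H] /(IHq _ _ pq H).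
- by move=> pq [[]//|H] bd; apply: IHq H _; [move: pq bd; case: eqVneq|lia].
Qed.

(** * Consequences of well-boundedness for binders and variables *)

Section WellNamed.
Context (phi : formula PS VS).
Hypotheses (hwf : well_formed phi) (hwb : well_bounded phi).

Lemma binders_fix e X p : subformula (FFix e X p) phi ->
  [/\ binders X phi = 1, binders X p = 0 & occurrences X phi <= 1].
Proof.
move=> /(subformula_binders X) /=; rewrite eqxx => le.
by have [|b1 o1] := @hwb X _; [lia|split=> //; lia].
Qed.

Lemma fix_unique b b' e e' X p p' :
  occ b (FFix e X p) phi -> occ b' (FFix e' X p') phi ->
  [/\ b = b', e = e' & p = p'].
Proof.
move=> H; have [bd _ _] := binders_fix (occ_subformula H).
by apply: occ_fix_unique H; rewrite bd.
Qed.

(* Positivity of X in the body makes the role at the bound occurrence of X the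
   same as at its binder. *)
Lemma bound_var_occ b X : occ b (FVar X) phi -> ~~ free X phi ->
  exists e p, occ b (FFix e X p) phi.
Proof.
move=> Hb nf; have [e [p [c [H1 H2]]]] := bound_occ Hb nf; exists e, p.
have sub1 := occ_subformula H1.
have [_ b0 _] := binders_fix sub1.
by have /eqP -> := polar_occ (hwf sub1) H2 b0.
Qed.

(** A free occurrence besides the one in the body would make two occurrences of a variable that has
    a binder. *)
Lemma bound_not_free e X p : subformula (FFix e X p) phi ->
  subformula (FVar X) p -> ~~ free X phi.
Proof.
move=> H /(subformula_occurrences X) /=; rewrite eqxx.
have [_ _ o1] := binders_fix H; have := fix_free_occurrences H.
by case: free => //=; lia.
Qed.

(** If X were bound in [p], it would have a binder in [phi] and yet occur at least twice, once in
    each operand. This allows the regions of two operands to be merged. *)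
Lemma free_in_sibling X p q : subformula (FVar X) p -> free X q ->
  occurrences X p + occurrences X q <= occurrences X phi ->
  subformula p phi -> free X p.
Proof.
move=> sX fq le sp; apply: contraT => nf.
have [b Hb] := subformula_occ sX.
have [e [r [c [H1 _]]]] := bound_occ Hb nf.
have [_ _ o1] := binders_fix (subformula_trans (occ_subformula H1) sp).
have := subformula_occurrences X sX; rewrite /= eqxx.
by have := free_occurrences fq; lia.
Qed.

End WellNamed.

End Occurrences.

(** * Approximants of a least fixed point, indexed by trees *)

Section Approximants.
Context (W : Type) (F : set W -> set W).
Hypothesis mF : monotone F.

(* Such trees play the role of ordinals: the comparison [tle] below makes them a
   total well-founded preorder, and they index the approximants of the least
   fixed point. *)
Inductive tree := Node (I : Type) of (I -> tree).

(** Transfinite iteration of F from the empty set: a node stands for the supremum of the successors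
    of its children. *)
Fixpoint approx (t : tree) : set W :=
  let: Node _ f := t in [set v | exists i, F (approx (f i)) v].

Fixpoint tle (s t : tree) : Prop :=
  let: Node _ f := s in let: Node _ g := t in
  forall i, exists j, tle (f i) (g j).

Definition tlt (s t : tree) : Prop :=
  let: Node _ g := t in exists j, tle s (g j).

(** By induction on the first tree: a child [f i] that is below no child of the second tree is
    strictly above each of them, hence weakly above the second tree itself. *)
Lemma tle_total s t : tle s t \/ tlt t s.
Proof.
elim: s t => I f IH [J g] /=; apply: contrapT => /not_orP[H1 H2].
apply: H1 => i; apply: contrapT => H; apply: H2; exists i.
have gf j : tlt (g j) (f i).
  by have [le|//] := IH i (g j); case: H; exists j.
by case: (f i) gf.
Qed.

Lemma approx_le s t : tle s t -> approx s `<=` approx t.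
Proof.
elim: s t => I f IH [J g] /= le v [i Fv]; have [j lej] := le i.
by exists j; apply: mF Fv; apply: IH.
Qed.

Lemma approx_step t : approx t `<=` F (approx t).
Proof.
elim: t => I f IH v /= [x Fv]; apply: mF Fv => u /IH Fu.
by exists x.
Qed.

Lemma approx_total s t : approx s `<=` approx t \/ approx t `<=` approx s.
Proof.
have [/approx_le|] := tle_total s t; first by left.
case: s => I f [x /approx_le le]; right => v /le /approx_step Fv.
by exists x.
Qed.

(** Well-foundedness comes from the trees: an approximant strictly inside that of a node is
    contained in the approximant of one of its children, and is either equal to it or strictly
    smaller. *)
Lemma wf_approx :
  well_founded (fun A B => [/\ range approx A, range approx B & A `<` B]).
Proof.
have H t : Acc (fun A B => [/\ range approx A, range approx B & A `<` B]) (approx t).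
  elim: t => I g IH; constructor => _ [[s _ <-] _ [le nle]].
  have [/approx_le/nle[]|[y /approx_le le']] := tle_total (Node g) s.
  have [ge|nge] := pselect (approx (g y) `<=` approx s).
    by have -> : approx s = approx (g y) by apply/seteqP.
  by apply: (Acc_inv (IH y)); split.
by move=> B; constructor => _ [[s _ <-] _ _].
Qed.

(** The union U is closed under F: choose a tree for each element of U and join all of them under
    one node, whose approximant then contains U. *)
Lemma approx_cover S : (forall A, F A `<=` A -> S `<=` A) ->
  S `<=` [set v | exists t, F (approx t) v].
Proof.
apply; set U := [set v | _].
have /choice[t_ Ht] : forall v : {v | U v}, exists t, F (approx t) (sval v).
  by move=> [v [t Ft]]; exists t.
move=> v FU; exists (Node t_); apply: mF FU => u Uu.
by exists (exist _ u Uu); apply: (Ht (exist _ u Uu)).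
Qed.

(** Descend through children whose approximants contain [v] until it drops out; since [v] separates
    the approximants of [s] and [t], totality makes the inclusion strict. *)
Lemma approx_lt t v : approx t v -> exists s, approx s `<` approx t /\ F (approx s) v.
Proof.
move=> tv; suff [s [Fs ns]] : exists s, F (approx s) v /\ ~ approx s v.
  have nle : ~ approx t `<=` approx s by move=> /(_ v tv).
  by exists s; split=> //; split=> //; case: (approx_total s t).
elim: t tv => I f IH /= [x Fv].
by have [/IH //|nv] := pselect (approx (f x) v); exists (f x).
Qed.

End Approximants.

(** * Regions of positions with a positional strategy, and ways to combine them *)

Section Game.
Context (PS : Type) (VS : eqType) (M : ckModel PS VS) (phi : formula PS VS).
Context (pl : player).

Notation pos := (position M).
Implicit Types (p q : pos) (r : nat -> pos) (T U : set pos) (psi chi : formula PS VS).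

Definition is_verifier (Q : role) : bool := if Q is Verifier then true else false.

(* Whether [pl] is the Verifier when player I has the role encoded by [b]. *)
Definition verifies (b : bool) : bool := if pl is PlayerI then b else ~~ b.

(** Whether [pl] profits from infinitely many regenerations of an [e]-formula occurring with parity
    [b]. *)
Definition favours (e : fixpoint_op) (b : bool) : bool :=
  if e is Nu then verifies b else ~~ verifies b.

(** Ownership is read off the parity of an occurrence rather than off reachability, so that the
    notion applies to plays starting anywhere. *)
Definition won r : Prop :=
  exists e X theta b, [/\ outermost_regenerated r (FFix e X theta),
    occ b (FFix e X theta) phi & favours e b].

(** The controllable predecessors of U in the usual sense of graph games. *)
Definition controls U p : Prop :=
  (owns phi pl p -> exists2 q, moves phi p q & U q) /\
  (~ owns phi pl p -> moves phi p `<=` U).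

(* On U, [pl] can play so as to stay in U until T is reached, and to win every
   infinite run that never reaches T. *)
Definition region T U : Prop := exists sigma,
  (forall p, U p -> ~ T p ->
     (owns phi pl p -> moves phi p (sigma p) /\ U (sigma p)) /\
     (~ owns phi pl p -> moves phi p `<=` U)) /\
  (forall r, (forall i, [/\ U (r i), ~ T (r i), moves phi (r i) (r i.+1)
     & follows_at phi pl sigma r i]) -> won r).

Lemma regenerates_shift r k theta :
  regenerates_infinitely_often (fun n => r (k + n)) theta <->
  regenerates_infinitely_often r theta.
Proof.
have E i : regenerates_at (fun n => r (k + n)) theta i = regenerates_at r theta (k + i).
  by rewrite /regenerates_at addnS.
split=> H n.
  by have [i ni] := H n; rewrite E => Hi; exists (k + i) => //; lia.
have [i ni Hi] := H (k + n); exists (i - k); first by lia.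
by rewrite E subnKC //; lia.
Qed.

Lemma won_shift r k : won (fun n => r (k + n)) -> won r.
Proof.
move=> [e [X [theta [b [[H1 H2] ? ?]]]]]; exists e, X, theta, b; split=> //.
split; first by apply/(regenerates_shift r k).
by move=> t /(regenerates_shift r k)/H2.
Qed.

Lemma region_weaken T T' U : T `<=` T' -> region T U -> region T' U.
Proof.
move=> sT [s [H1 H2]]; exists s; split=> [p Up nT|r Hr].
  by apply: H1 => // /sT.
by apply: H2 => i; have [? nT ? ?] := Hr i; split=> // /sT.
Qed.

(** At each position the strategy of the least index available there is followed. Along a play this
    index never increases, and it drops whenever the target of the current region is met, so from
    some point on the play follows a single strategy away from its target. *)
Lemma region_glue (I : Type) (i0 : I) (D : set I) (lt : I -> I -> Prop)
    (T_ U_ : I -> set pos) T :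
  well_founded lt -> (forall i j k, lt i j -> lt j k -> lt i k) ->
  (forall i j, D i -> D j -> [\/ i = j, lt i j | lt j i]) ->
  (forall i, D i -> region (T_ i) (U_ i)) ->
  (forall i p, D i -> U_ i p -> T_ i p -> ~ T p ->
     controls [set q | exists2 j, D j /\ lt j i & U_ j q] p) ->
  region T [set p | exists2 i, D i & U_ i p].
Proof.
move=> wf tr tot reg ctl; set U := [set p | _].
have /choice[s_ Hs] : forall i, exists s, D i ->
  (forall p, U_ i p -> ~ T_ i p ->
     (owns phi pl p -> moves phi p (s p) /\ U_ i (s p)) /\
     (~ owns phi pl p -> moves phi p `<=` U_ i)) /\
  (forall r, (forall k, [/\ U_ i (r k), ~ T_ i (r k), moves phi (r k) (r k.+1)
     & follows_at phi pl s r k]) -> won r).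
  move=> i; have [/reg[s Hs]|nD] := pselect (D i); first by exists s.
  by exists id.
(* The index [rho p] is minimal among those whose set contains [p]. It depends on the position
   alone, which keeps the glued strategy positional; [i0] is only its value outside [U]. *)
have /choice[rho Hrho] : forall p, exists i, U p ->
    [/\ D i, U_ i p & forall j, D j -> U_ j p -> ~ lt j i].
  move=> p; have [[i Di Ui]|nU] := pselect (U p); last by exists i0.
  elim/(well_founded_ind wf): i Di Ui => i IH Di Ui.
  have [[j [Dj Uj ltj]]|nj] := pselect (exists j, [/\ D j, U_ j p & lt j i]).
    exact: IH ltj Dj Uj.
  by exists i => _; split=> // j Dj Uj ltj; apply: nj; exists j.
have rho_le i p : D i -> U_ i p -> rho p = i \/ lt (rho p) i.
  move=> Di Ui; have [|Dr Ur min] := Hrho p; first by exists i.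
  by case: (tot _ _ Dr Di) => [|lt1|/(min _ Di Ui)]; [left|right|].
have /choice[d Hd] : forall p, exists q, U p -> T_ (rho p) p -> ~ T p ->
    owns phi pl p -> moves phi p q /\ exists2 j, D j /\ lt j (rho p) & U_ j q.
  move=> p; have [[Up Tp nT op]|n] := pselect [/\ U p, T_ (rho p) p, ~ T p & owns phi pl p].
    have [Dr Ur _] := Hrho p Up; have [/(_ op)[q mq Uq] _] := ctl _ _ Dr Ur Tp nT.
    by exists q.
  by exists p => *; case: n.
pose s p := if pselect (T_ (rho p) p) then d p else s_ (rho p) p.
have safe p : U p -> ~ T p ->
    (owns phi pl p -> moves phi p (s p) /\ U (s p)) /\
    (~ owns phi pl p -> moves phi p `<=` U).
  move=> Up nT; have [Dr Ur _] := Hrho p Up; rewrite /s.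
  case: pselect => Tp; split=> op.
  - by have [mq [j [Dj _] Uj]] := Hd _ Up Tp nT op; split=> //; exists j.
  - have [_ /(_ op) sub] := ctl _ _ Dr Ur Tp nT.
    by move=> q /sub [j [Dj _] Uj]; exists j.
  - have [/(_ _ Ur Tp)[/(_ op)[mq Uq] _] _] := Hs _ Dr.
    by split=> //; exists (rho p).
  - have [/(_ _ Ur Tp)[_ /(_ op) sub] _] := Hs _ Dr.
    by move=> q /sub Uq; exists (rho p).
exists s; split=> // r.
have [i0' Ei] : exists i, i = rho (r 0) by exists (rho (r 0)).
elim/(well_founded_ind wf): i0' r Ei => i IH r Ei Hr.
(* Away from the target the successor remains in the same set, so its minimal index is no larger; at
   the target [ctl] provides a strictly smaller index. *)
have step k : rho (r k.+1) = rho (r k) /\ ~ T_ (rho (r k)) (r k) \/ lt (rho (r k.+1)) (rho (r k)).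
  have [Uk nT mk fk] := Hr k; have [Dr Ur _] := Hrho _ Uk.
  have [Tk|nTk] := pselect (T_ (rho (r k)) (r k)).
    suff [j [Dj lj] Uj] : exists2 j, D j /\ lt j (rho (r k)) & U_ j (r k.+1).
      by right; have [->//|lt1] := rho_le _ _ Dj Uj; apply: tr lj.
    have [op|nop] := pselect (owns phi pl (r k)).
      have [_] := Hd _ Uk Tk nT op.
      by rewrite fk // /s; case: pselect.
    by have [_ /(_ nop) sub] := ctl _ _ Dr Ur Tk nT; exact: (sub _ mk).
  suff Uk1 : U_ (rho (r k)) (r k.+1).
    by have [|] := rho_le _ _ Dr Uk1; [left|right].
  have [op|nop] := pselect (owns phi pl (r k)).
    have [/(_ _ Ur nTk)[/(_ op)[_ Uq] _] _] := Hs _ Dr.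
    by rewrite fk // /s; case: pselect.
  by have [/(_ _ Ur nTk)[_ /(_ nop) sub] _] := Hs _ Dr; exact: (sub _ mk).
have le k : rho (r k) = i \/ lt (rho (r k)) i.
  elim: k => [|k [IHk|IHk]]; first by left.
    by case: (step k) => [[-> _]|]; rewrite IHk; [left|right].
  by right; case: (step k) => [[-> _]//|lt1]; apply: tr IHk.
(* If the index drops at some point, the induction hypothesis applies to the tail from there;
   otherwise it is constant and the play belongs to one region. *)
have [[k lk]|nlt] := pselect (exists k, lt (rho (r k)) i).
  apply: (@won_shift _ k); apply: (IH _ lk); first by rewrite addn0.
  by move=> j; rewrite /follows_at addnS; apply: Hr.
have const k : rho (r k) = i by case: (le k) => // lk; case: nlt; exists k.
have [U0 _ _ _] := Hr 0; have [Di _ _] := Hrho _ U0; rewrite -Ei in Di.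
have [_] := Hs _ Di; apply=> k; have [Uk nT mk fk] := Hr k.
have [_ Ur _] := Hrho _ Uk; rewrite const in Ur.
have nTk : ~ T_ i (r k).
  have [[_]|lk] := step k; first by rewrite const.
  by case: nlt; exists k.+1; rewrite -(const k).
by split=> // op; rewrite fk // /s; case: pselect => //; rewrite const.
Qed.

Lemma wf_bool : well_founded (fun b c : bool => ~~ b && c).
Proof.
have A0 : Acc (fun b c : bool => ~~ b && c) false by constructor; case.
by case; [constructor; case=> [/andP[]|_]|]; try exact: A0.
Qed.

Lemma region_union T U1 U2 : region T U1 -> region T U2 -> region T (U1 `|` U2).
Proof.
move=> R1 R2.
have -> : U1 `|` U2 = [set p | exists2 b, setT b & (if b then U2 else U1) p].
  apply/seteqP; split=> p; first by case=> H; [exists false|exists true].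
  by case=> -[] _ H; [right|left].
apply: (@region_glue _ false setT _ (fun=> T) _ _ wf_bool) => //.
- by case=> -[] [].
- by case=> -[] _ _; constructor.
- by case.
Qed.

Lemma region_step T U N : region T U ->
  (forall p, N p -> ~ T p -> controls U p) -> region T (U `|` N).
Proof.
move=> R1 ctl.
have -> : U `|` N = [set p | exists2 b, setT b & (if b then N else U) p].
  apply/seteqP; split=> p; first by case=> H; [exists false|exists true].
  by case=> -[] _ H; [right|left].
(* The upper index [true] stands for N with every position as target, so that a play in N must pass
   to U at once. *)
apply: (@region_glue _ false setT _ (fun b => if b then setT else T) _ _ wf_bool)
  => //.
- by case=> -[] [].
- by case=> -[] _ _; constructor.
- by case=> // _; exists id; split=> [p _ /(_ I)|r /(_ 0)[_ /(_ I)]].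
- case=> // p _ Np _ nT; have [c1 c2] := ctl _ Np nT; split=> [/c1[q mq Uq]|/c2 sub q /sub Uq].
    by exists q => //; exists false.
  by exists false.
Qed.

(** Removes B from the target: a move back into U is prescribed on B. Either B is then visited
    infinitely often, or some tail avoids it and is won by the given strategy. *)
Lemma region_recur T B U : region (T `|` B) U ->
  (forall p, U p -> B p -> ~ T p -> controls U p) ->
  (forall r, (forall i, U (r i) /\ moves phi (r i) (r i.+1)) ->
     (forall n, exists2 i, n <= i & B (r i)) -> won r) ->
  region T U.
Proof.
move=> [s [H1 H2]] ctl Binf.
have /choice[d Hd] : forall p, exists q, U p -> B p -> ~ T p -> owns phi pl p ->
    moves phi p q /\ U q.
  move=> p; have [[Up Bp nT op]|n] := pselect [/\ U p, B p, ~ T p & owns phi pl p].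
    by have [/(_ op)[q mq Uq] _] := ctl _ Up Bp nT; exists q.
  by exists p => *; case: n.
exists (fun p => if pselect (B p) then d p else s p); split=> [p Up nT|r Hr].
  case: pselect => Bp; last by apply: H1 => // -[].
  by have [_ c2] := ctl _ Up Bp nT; split=> // op; apply: Hd.
have [inf|/existsNP[n Hn]] := pselect (forall n, exists2 i, n <= i & B (r i)).
  by apply: Binf inf => i; have [] := Hr i.
apply: (@won_shift _ n); apply: H2 => i; have [Ui nT mi fi] := Hr (n + i).
have nB : ~ B (r (n + i)) by move=> Bi; apply: Hn; exists (n + i) => //; lia.
rewrite /follows_at addnS; split=> // [[//|//]|op].
by rewrite fi //; case: pselect.
Qed.

Lemma region0 T : region T set0.
Proof. by exists id; split=> // r /(_ 0)[]. Qed.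

End Game.

(** * Legal positions: roles determined by parity of occurrence *)

Section Adequacy.
Context (PS : Type) (VS : eqType) (M : ckModel PS VS) (phi : formula PS VS).
Hypotheses (hwf : well_formed phi) (hwb : well_bounded phi).

Notation pos := (position M).
Notation valuation := (PS + VS -> set M).
Implicit Types (psi chi theta : formula PS VS) (V : valuation) (v u : M) (Q : role).

(** An invariant of reachable positions: the role of player I records the parity of some occurrence
    of the formula in [phi]. *)
Definition legal (p : pos) : Prop :=
  match p with
  | PMain _ chi Q => occ (is_verifier Q) chi phi
  | PDia _ chi Q => occ (is_verifier Q) (FDia chi) phi
  | PBox _ chi Q => occ (is_verifier Q) (FBox chi) phi
  | PImp _ chi theta Q => occ (is_verifier Q) (FImp chi theta) phi
  end.

Lemma legal_position p : legal p -> is_position phi p.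
Proof. by case: p => >; apply: occ_subformula. Qed.

Lemma occ_child chi psi Q : occ true chi psi ->
  occ (is_verifier Q) psi phi -> occ (is_verifier Q) chi phi.
Proof. by move=> H1 H2; have := occ_trans H1 H2; case: Q {H2}. Qed.

Lemma occ_flip chi psi Q : occ false chi psi ->
  occ (is_verifier Q) psi phi -> occ (is_verifier (dual Q)) chi phi.
Proof. by move=> H1 H2; have := occ_trans H1 H2; case: Q {H2}. Qed.

Lemma legal_moves p q : legal p -> moves phi p q -> legal q.
Proof.
have child := occ_child; have flip := occ_flip.
case: p => [v chi Q|v chi Q|v chi Q|v chi theta Q] /= lp.
- case=> _; case: chi lp => [P|X|||p|p p'|p p'|p p'|p|p|e X p] lp //=.
  (* A regeneration keeps the role: by positivity the binder occurs with the parity of the variable,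
     and it is the only binder of that variable. *)
  + move=> [nf [e [theta [H ->]]]] /=.
    have [e' [theta' H']] := bound_var_occ hwf hwb lp nf.
    have [b Hb] := subformula_occ H.
    by have [_ <- <-] := fix_unique hwb H' Hb.
  + by move=> [u _ ->] /=; apply: flip lp; right; apply: occ_refl.
  + by move=> [|] -> /=; apply: child lp; right; [left|right]; apply: occ_refl.
  + by move=> [|] -> /=; apply: child lp; right; [left|right]; apply: occ_refl.
  + by move=> [u _ ->].
  + by move=> [u _ ->].
  + by move=> [u _ ->].
  + by move=> -> /=; apply: child lp; right; apply: occ_refl.
- by move=> [u _ ->] /=; apply: child lp; right; apply: occ_refl.
- by move=> [u _ ->] /=; apply: child lp; right; apply: occ_refl.
- move=> [|] -> /=; first by apply: flip lp; right; left; apply: occ_refl.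
  by apply: child lp; right; right; apply: occ_refl.
Qed.

Lemma is_position_sub chi psi (p : pos) : subformula chi psi ->
  is_position chi p -> is_position psi p.
Proof. by move=> s; case: p => > /= H; apply: subformula_trans s. Qed.

(** * The inductive statement for one player: sound and complete regions *)

Section Regions.
Context (pl : player).

Definition role_in (p : pos) : role :=
  match p with PMain _ _ Q | PDia _ _ Q | PBox _ _ Q | PImp _ _ _ Q => Q end.

Notation verif Q := (verifies pl (is_verifier Q)).
Notation controls := (controls phi pl).
Notation region := (region phi pl).

Lemma verifies_dual Q : verif (dual Q) = ~~ verif Q.
Proof. by case: Q; rewrite /verifies; case: pl. Qed.

Lemma ownsE (p : pos) :
  owns phi pl p <-> is_verifier (owner_role phi p) = verif (role_in p).
Proof.
rewrite /owns /verifies; case: (owner_role phi p); 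
  case: p => [v chi Q|v chi Q|v chi Q|v chi theta Q] /=; by case: pl; case: Q.
Qed.

Lemma controls_verifier U p : owner_role phi p = Verifier ->
  (verif (role_in p) -> exists2 q, moves phi p q & U q) ->
  (~~ verif (role_in p) -> moves phi p `<=` U) -> controls U p.
Proof.
move=> ow H1 H2; split=> /ownsE; rewrite ow /=; first by move=> /esym/H1.
by move=> /eqP; rewrite eq_sym eqb_id => /H2.
Qed.

Lemma controls_refuter U p : owner_role phi p = Refuter ->
  (verif (role_in p) -> moves phi p `<=` U) ->
  (~~ verif (role_in p) -> exists2 q, moves phi p q & U q) -> controls U p.
Proof.
move=> ow H1 H2; split=> /ownsE; rewrite ow /=; first by move=> /esym/negbT/H2.
by move=> H; apply: H1; case: (verif _) H.
Qed.

(** Complementation for the Refuter lets either player be treated as one who wants to be inside the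
    set. *)
Definition signed (c : bool) (A : set M) : set M := if c then A else ~` A.

Definition holds V chi v Q : Prop := signed (verif Q) (sem V chi) v.

Lemma holds_fallible V chi v Q : fallible v -> holds V chi v Q -> verif Q.
Proof.
by rewrite /holds /signed => fv; case: ifP => // _ []; apply: sem_fallible.
Qed.

Lemma controls_fallible U chi v Q : fallible v -> verif Q ->
  controls U (PMain v chi Q).
Proof.
move=> fv vQ; apply: controls_refuter; rewrite /= ?vQ ?asboolT // => _ q.
by case.
Qed.

Definition open_vars psi : set pos :=
  [set p | exists v X Q, p = PMain v (FVar X) Q /\ free X psi].

(** Free variables of [psi] are the exits of the region, and the last clause makes each exit reached
    favourable to [pl] under [V]. *)
Definition sound V psi (U : set pos) : Prop :=
  [/\ region (open_vars psi) U, forall p, U p -> is_position psi p /\ legal p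
    & forall v X Q, U (PMain v (FVar X) Q) -> free X psi -> holds V (FVar X) v Q].

Definition complete V psi (U : set pos) : Prop :=
  forall v Q, legal (PMain v psi Q) -> holds V psi v Q -> U (PMain v psi Q).

Lemma sound0 V psi : sound V psi set0.
Proof. by split=> //; apply: region0. Qed.

Lemma sound_union V psi U1 U2 : sound V psi U1 -> sound V psi U2 ->
  sound V psi (U1 `|` U2).
Proof.
move=> [R1 I1 H1] [R2 I2 H2]; split; first exact: region_union.
  by move=> p [/I1|/I2].
by move=> v X Q [/H1|/H2].
Qed.

(** The last hypothesis prevents a variable bound in [chi] from becoming an exit of [psi], where
    nothing would be known about its value. *)
Lemma sound_lift V psi chi U : sound V chi U -> subformula chi psi ->
  (forall X, free X chi -> free X psi) ->
  (forall X, subformula (FVar X) chi -> free X psi -> free X chi) ->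
  sound V psi U.
Proof.
move=> [R1 I1 H1] s f1 f2; split.
- apply: region_weaken R1 => p [v [X [Q [-> fX]]]].
  by exists v, X, Q; split=> //; apply: f1.
- by move=> p /I1[Ip lp]; split=> //; apply: is_position_sub s Ip.
- by move=> v X Q UX fX; apply: H1 => //; apply: f2 => //; have [] := I1 _ UX.
Qed.

Lemma sound_step V psi U (N : set pos) : sound V psi U ->
  (forall p, N p -> [/\ is_position psi p, legal p & controls U p]) ->
  (forall v X Q, ~ N (PMain v (FVar X) Q)) -> sound V psi (U `|` N).
Proof.
move=> [R1 I1 H1] HN nN; split.
- by apply: region_step => // p /HN[].
- by move=> p [/I1|/HN[]].
- by move=> v X Q [/H1|/nN].
Qed.

(** The positions at [psi] true for [pl] are added as one more layer. Fallible worlds are settled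
    here once and for all: there [pl] is the Verifier and the Refuter is stuck. *)
Lemma sound_main V psi U : sound V psi U ->
  (forall v Q, ~ fallible v -> legal (PMain v psi Q) -> holds V psi v Q ->
     ~ open_vars psi (PMain v psi Q) -> controls U (PMain v psi Q)) ->
  exists U', sound V psi U' /\ complete V psi U'.
Proof.
move=> [R1 I1 H1] ctl.
pose N := [set p | exists v Q, [/\ p = PMain v psi Q, legal p & holds V psi v Q]].
exists (U `|` N); split; last by move=> v Q lv hv; right; exists v, Q.
split.
- apply: region_step => // p [v [Q [-> lv hv]]] nT.
  have [fv|nfv] := pselect (fallible v); first exact: controls_fallible (holds_fallible fv hv).
  exact: ctl.
- by move=> p [/I1//|[v [Q [-> lv hv]]]]; split=> //=; case: (psi); left.
- by move=> v X Q [/H1//|[v' [Q' [[-> <- ->] _ hv]]]].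
Qed.

(** The game reads proposition symbols from the model, so [V] must agree with it there; on variables
    it is arbitrary, since fixed points substitute arbitrary sets. *)
Definition solvable psi : Prop := forall V, (forall P, V (inl P) = valn (inl P)) ->
  exists U, sound V psi U /\ complete V psi U.

Lemma occurrences_binop X chi (p q : formula PS VS) : subformula chi phi ->
  occurrences X chi = occurrences X p + occurrences X q ->
  occurrences X p + occurrences X q <= occurrences X phi.
Proof. by move=> /(subformula_occurrences X) + <-. Qed.

Lemma sound_binop V chi p q U1 U2 : subformula chi phi ->
  subformula p chi -> subformula q chi ->
  (forall X, free X chi = free X p || free X q) ->
  (forall X, occurrences X chi = occurrences X p + occurrences X q) ->
  sound V p U1 -> sound V q U2 -> sound V chi (U1 `|` U2).
Proof.
move=> sc sp sq fE oE S1 S2; apply: sound_union.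
- apply: sound_lift S1 _ _ _ => // X; first by rewrite fE => ->.
  rewrite fE => sX /orP[//|fq]; apply: (free_in_sibling hwb sX fq).
    exact: occurrences_binop (oE X).
  exact: subformula_trans sc.
- apply: sound_lift S2 _ _ _ => // X; first by rewrite fE => ->; rewrite orbT.
  rewrite fE => sX /orP[fp|//]; apply: (free_in_sibling hwb sX fp).
    by rewrite addnC; apply: occurrences_binop (oE X).
  exact: subformula_trans sc.
Qed.

(** * Atomic, propositional and modal cases *)

Lemma solvable_prop P : solvable (FProp P).
Proof.
move=> V VP; apply: sound_main (sound0 _ _) _ => v Q nf _ hv _.
move: hv; rewrite /holds /signed /=.
have [vP|nP] := pselect (valn (inl P) v).
  case: ifP => vQ hv; last by case: hv; right; rewrite VP.
  by apply: controls_refuter; rewrite /= ?(asboolF nf) ?(asboolT vP) ?vQ // => _ q [].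
case: ifP => vQ hv; first by case: hv => //; rewrite VP.
by apply: controls_verifier; rewrite /= ?(asboolF nf) ?(asboolF nP) ?vQ // => _ q [].
Qed.

Lemma solvable_var X : solvable (FVar X).
Proof.
move=> V VP; apply: sound_main (sound0 _ _) _ => v Q nf _ _ [].
by exists v, X, Q; rewrite /= eqxx.
Qed.

Lemma solvable_bot : solvable FBot.
Proof.
move=> V VP; apply: sound_main (sound0 _ _) _ => v Q nf _ hv _.
move: hv; rewrite /holds /signed /=; case: ifP => vQ hv; first by case: hv.
by apply: controls_verifier; rewrite /= ?(asboolF nf) ?vQ // => _ q [].
Qed.

Lemma solvable_top : solvable FTop.
Proof.
move=> V VP; apply: sound_main (sound0 _ _) _ => v Q nf _ hv _.
move: hv; rewrite /holds /signed /=; case: ifP => vQ hv; last by case: hv; right.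
by apply: controls_refuter; rewrite /= ?(asboolF nf) ?vQ // => _ q [].
Qed.

Lemma solvable_neg p : solvable p -> solvable (FNeg p).
Proof.
move=> IH V VP; have [U [S C]] := IH V VP.
have S' : sound V (FNeg p) U.
  by apply: sound_lift S _ _ _ => //; right; apply: occ_subformula (occ_refl p).
apply: sound_main S' _ => v Q nf lv + _.
have mv u : prec v u -> moves phi (PMain v (FNeg p) Q) (PMain u p (dual Q)).
  by move=> vu; split=> //; exists u.
rewrite /holds /signed /=; case: ifP => vQ hv;
  apply: controls_refuter; rewrite /= ?(asboolF nf) ?vQ // => _.
  move=> q [_ [u vu ->]]; apply: C; first exact: legal_moves (mv u vu).
  by rewrite /holds verifies_dual vQ; case: hv => // /(_ _ vu).
have /existsNP[u /not_implyP[vu /contrapT su]] : ~ forall u, prec v u -> ~ sem V p u.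
  by move=> H; apply: hv; right.
exists (PMain u p (dual Q)); first exact: mv.
apply: C; first exact: legal_moves (mv u vu).
by rewrite /holds verifies_dual vQ.
Qed.

Lemma solvable_and p q : subformula (FAnd p q) phi ->
  solvable p -> solvable q -> solvable (FAnd p q).
Proof.
move=> sub IHp IHq V VP; have [U1 [S1 C1]] := IHp V VP; have [U2 [S2 C2]] := IHq V VP.
have sp := occ_subformula (occ_refl p); have sq := occ_subformula (occ_refl q).
have S : sound V (FAnd p q) (U1 `|` U2).
  by apply: sound_binop S1 S2 => //=; right; [left|right].
apply: sound_main S _ => v Q nf lv + _.
have m1 : moves phi (PMain v (FAnd p q) Q) (PMain v p Q) by split=> //; left.
have m2 : moves phi (PMain v (FAnd p q) Q) (PMain v q Q) by split=> //; right.
have l1 := legal_moves lv m1; have l2 := legal_moves lv m2.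
rewrite /holds /signed /=; case: ifP => vQ hv;
  apply: controls_refuter; rewrite /= ?(asboolF nf) ?vQ // => _.
  case: hv => // -[hp hq] r [_ [|] ->]; [left; apply: C1|right; apply: C2] => //;
    by rewrite /holds vQ.
have [hp|hp] := pselect (sem V p v); last first.
  by exists (PMain v p Q) => //; left; apply: C1 => //; rewrite /holds vQ.
exists (PMain v q Q) => //; right; apply: C2 => //; rewrite /holds vQ => hq.
by apply: hv; right.
Qed.

Lemma solvable_or p q : subformula (FOr p q) phi ->
  solvable p -> solvable q -> solvable (FOr p q).
Proof.
move=> sub IHp IHq V VP; have [U1 [S1 C1]] := IHp V VP; have [U2 [S2 C2]] := IHq V VP.
have sp := occ_subformula (occ_refl p); have sq := occ_subformula (occ_refl q).
have S : sound V (FOr p q) (U1 `|` U2).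
  by apply: sound_binop S1 S2 => //=; right; [left|right].
apply: sound_main S _ => v Q nf lv + _.
have m1 : moves phi (PMain v (FOr p q) Q) (PMain v p Q) by split=> //; left.
have m2 : moves phi (PMain v (FOr p q) Q) (PMain v q Q) by split=> //; right.
have l1 := legal_moves lv m1; have l2 := legal_moves lv m2.
rewrite /holds /signed /=; case: ifP => vQ hv;
  apply: controls_verifier; rewrite /= ?(asboolF nf) ?vQ // => _.
  case: hv => // -[h|h]; [exists (PMain v p Q)|exists (PMain v q Q)] => //;
    by [left; apply: C1 => //; rewrite /holds vQ|right; apply: C2 => //; rewrite /holds vQ].
by move=> r [_ [|] ->]; [left; apply: C1|right; apply: C2] => //;
  rewrite /holds vQ => h; apply: hv; right; [left|right].
Qed.

Lemma solvable_imp p q : subformula (FImp p q) phi ->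
  solvable p -> solvable q -> solvable (FImp p q).
Proof.
move=> sub IHp IHq V VP; have [U1 [S1 C1]] := IHp V VP; have [U2 [S2 C2]] := IHq V VP.
have sp := occ_subformula (occ_refl p); have sq := occ_subformula (occ_refl q).
have S : sound V (FImp p q) (U1 `|` U2).
  by apply: sound_binop S1 S2 => //=; right; [left|right].
(* An intermediate layer of auxiliary positions, for which the implication is evaluated at the world
   [u] alone. *)
pose N := [set r : pos | exists u Q, [/\ r = PImp u p q Q, legal r
  & signed (verif Q) [set u | sem V p u -> sem V q u] u]].
have {}S : sound V (FImp p q) ((U1 `|` U2) `|` N).
  apply: sound_step S _ _ => [r [u [Q [-> lr h]]]|v X Q [u [Q' []]]//].
  split=> //; first exact: occ_subformula (occ_refl (FImp p q)).
  have m1 : moves phi (PImp u p q Q) (PMain u p (dual Q)) by left.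
  have m2 : moves phi (PImp u p q Q) (PMain u q Q) by right.
  have l1 := legal_moves lr m1; have l2 := legal_moves lr m2.
  move: h; rewrite /signed; case: ifP => vQ h; apply: controls_verifier; rewrite //= ?vQ // => _.
    have [hp|hp] := pselect (sem V p u); last first.
      exists (PMain u p (dual Q)) => //; left; apply: C1 => //.
      by rewrite /holds verifies_dual vQ.
    exists (PMain u q Q) => //; right; apply: C2 => //.
    by rewrite /holds vQ; apply: h.
  have /not_implyP[hp hq] := h.
  by move=> r' [|] ->; [left; apply: C1|right; apply: C2] => //;
    rewrite /holds ?verifies_dual vQ.
apply: sound_main S _ => v Q nf lv + _.
have mv u : prec v u -> moves phi (PMain v (FImp p q) Q) (PImp u p q Q).
  by move=> vu; split=> //; exists u.
rewrite /holds /signed /=; case: ifP => vQ hv;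
  apply: controls_refuter; rewrite /= ?(asboolF nf) ?vQ // => _.
  move=> r [_ [u vu ->]]; right; exists u, Q; split=> //.
  by rewrite vQ; case: hv => // /(_ _ vu).
have /existsNP[u /not_implyP[vu h]] : ~ forall u, prec v u -> sem V p u -> sem V q u.
  by move=> H; apply: hv; right.
exists (PImp u p q Q); first exact: mv.
by right; exists u, Q; split=> //; rewrite vQ.
Qed.

Lemma solvable_box p : solvable p -> solvable (FBox p).
Proof.
move=> IH V VP; have [U [S C]] := IH V VP.
have {}S : sound V (FBox p) U.
  by apply: sound_lift S _ _ _ => //; right; apply: occ_subformula (occ_refl p).
pose N := [set r : pos | exists u Q, [/\ r = PBox u p Q, legal r
  & signed (verif Q) [set u | forall u', acc u u' -> sem V p u'] u]].
have {}S : sound V (FBox p) (U `|` N).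
  apply: sound_step S _ _ => [r [u [Q [-> lr h]]]|v X Q [u [Q' []]]//].
  split=> //; first exact: occ_subformula (occ_refl (FBox p)).
  have mv u' : acc u u' -> moves phi (PBox u p Q) (PMain u' p Q) by exists u'.
  move: h; rewrite /signed; case: ifP => vQ h; apply: controls_refuter; rewrite //= ?vQ // => _.
    move=> r' [u' uu' ->]; apply: C; first exact: legal_moves (mv _ uu').
    by rewrite /holds vQ; apply: h.
  have /existsNP[u' /not_implyP[uu' hu']] := h.
  exists (PMain u' p Q); first exact: mv.
  by apply: C; [exact: legal_moves (mv _ uu')|rewrite /holds vQ].
apply: sound_main S _ => v Q nf lv + _.
have mv u : prec v u -> moves phi (PMain v (FBox p) Q) (PBox u p Q).
  by move=> vu; split=> //; exists u.
rewrite /holds /signed /=; case: ifP => vQ hv;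
  apply: controls_refuter; rewrite /= ?(asboolF nf) ?vQ // => _.
  move=> r [_ [u vu ->]]; right; exists u, Q; split=> //.
  by rewrite vQ; case: hv => // H u'; apply: H.
have /existsNP[u /not_implyP[vu h]] :
    ~ forall u, prec v u -> forall u', acc u u' -> sem V p u'.
  by move=> H; apply: hv; right=> u u' vu; apply: H.
exists (PBox u p Q); first exact: mv.
by right; exists u, Q; split=> //; rewrite vQ.
Qed.

Lemma solvable_dia p : solvable p -> solvable (FDia p).
Proof.
move=> IH V VP; have [U [S C]] := IH V VP.
have {}S : sound V (FDia p) U.
  by apply: sound_lift S _ _ _ => //; right; apply: occ_subformula (occ_refl p).
pose N := [set r : pos | exists u Q, [/\ r = PDia u p Q, legal r
  & signed (verif Q) [set u | exists2 u', acc u u' & sem V p u'] u]].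
have {}S : sound V (FDia p) (U `|` N).
  apply: sound_step S _ _ => [r [u [Q [-> lr h]]]|v X Q [u [Q' []]]//].
  split=> //; first exact: occ_subformula (occ_refl (FDia p)).
  have mv u' : acc u u' -> moves phi (PDia u p Q) (PMain u' p Q) by exists u'.
  move: h; rewrite /signed; case: ifP => vQ h; apply: controls_verifier; rewrite //= ?vQ // => _.
    have [u' uu' hu'] := h; exists (PMain u' p Q); first exact: mv.
    by apply: C; [exact: legal_moves (mv _ uu')|rewrite /holds vQ].
  move=> r' [u' uu' ->]; apply: C; first exact: legal_moves (mv _ uu').
  by rewrite /holds vQ => hu'; apply: h; exists u'.
apply: sound_main S _ => v Q nf lv + _.
have mv u : prec v u -> moves phi (PMain v (FDia p) Q) (PDia u p Q).
  by move=> vu; split=> //; exists u.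
rewrite /holds /signed /=; case: ifP => vQ hv;
  apply: controls_refuter; rewrite /= ?(asboolF nf) ?vQ // => _.
  move=> r [_ [u vu ->]]; right; exists u, Q; split=> //.
  by rewrite vQ; case: hv => // H; apply: H.
have /existsNP[u /not_implyP[vu h]] :
    ~ forall u, prec v u -> exists2 u', acc u u' & sem V p u'.
  by move=> H; apply: hv; right.
exists (PDia u p Q); first exact: mv.
by right; exists u, Q; split=> //; rewrite vQ.
Qed.

Lemma signedK c : involutive (signed c).
Proof. by case: c => A //=; rewrite /signed setCK. Qed.

(** * The fixed-point case *)

Section FixedPoint.
Context (e : fixpoint_op) (X : VS) (p : formula PS VS) (b : bool) (V : valuation).
Let psi := FFix e X p.
Hypothesis occ_psi : occ b psi phi.
Let c := verifies pl b.

(* The operator of the fixed point as seen by [pl]: complemented on both sides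
   if [pl] is the Refuter there, so that [pl] always wants to be inside. *)
Let F (A : set M) : set M := signed c (sem (update V X (signed c A)) p).

Context (U_ : set M -> set pos).
Hypothesis HU : forall A, sound (update V X (signed c A)) p (U_ A) /\
  complete (update V X (signed c A)) p (U_ A).

Let sub_psi : subformula psi phi := occ_subformula occ_psi.
Let N A : set pos := [set r | exists v Q, [/\ r = PMain v psi Q, legal r & F A v]].
Let Xpos : set pos := [set r | exists v Q, r = PMain v (FVar X) Q].

Lemma fix_operator_monotone : monotone F.
Proof.
have mono := @sem_monotone _ _ M V X p (hwf sub_psi).
move=> A B AB; rewrite /F /signed; case: (c); first exact: mono.
by apply: subsetC; apply: mono; apply: subsetC.
Qed.

Lemma fix_role v Q : legal (PMain v psi Q) -> is_verifier Q = b.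
Proof. by move=> l; have [] := fix_unique hwb l occ_psi. Qed.

Lemma fix_var_free : subformula (FVar X) p -> free X p.
Proof.
move=> sX; apply: contraT => nf; have [d Hd] := subformula_occ sX.
have [e' [q [d' [H _]]]] := bound_occ Hd nf.
have := subformula_binders X (occ_subformula H); rewrite /= eqxx.
by have [_ -> _] := binders_fix hwb sub_psi.
Qed.

Lemma fix_var_position A v Q : U_ A (PMain v (FVar X) Q) ->
  [/\ subformula (FVar X) p, legal (PMain v (FVar X) Q) & legal (PMain v psi Q)].
Proof.
move=> UX; have [[_ I _] _] := HU A; have [sX lX] := I _ UX.
have [e' [q H]] := bound_var_occ hwf hwb lX (bound_not_free hwb sub_psi sX).
by split=> //=; rewrite /psi; have [_ <- <-] := fix_unique hwb H occ_psi.
Qed.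

Lemma fix_var_moves v Q q : subformula (FVar X) p -> ~ fallible v ->
  moves phi (PMain v (FVar X) Q) q <-> q = PMain v psi Q.
Proof.
move=> sX nfv; split=> [[_ [_ [e' [q' [H ->]]]]]|->].
  have [d Hd] := subformula_occ H.
  by have [_ -> ->] := fix_unique hwb Hd occ_psi.
by split=> //; split; [exact: bound_not_free sub_psi sX|exists e, p].
Qed.

(** Soundness for the body gives [A v], X being free there. The regeneration is the only move, so it
    does not matter who makes it. *)
Lemma fix_var_controls A U v Q : U_ A (PMain v (FVar X) Q) ->
  (legal (PMain v psi Q) -> A v -> U (PMain v psi Q)) ->
  controls U (PMain v (FVar X) Q).
Proof.
move=> UX HA; have [sX _ lpsi] := fix_var_position UX.
have [[_ _ H] _] := HU A; have := H _ _ _ UX (fix_var_free sX).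
have [fv /(holds_fallible fv)|nfv hv] := pselect (fallible v).
  exact: controls_fallible.
have Up : U (PMain v psi Q).
  apply: HA => //; move: hv; rewrite /holds (fix_role lpsi) -/c /signed /= eqxx.
  by case: (c) => [[]//|nA]; apply: contrapT => nAv; apply: nA; right.
have mP := fix_var_moves Q _ sX nfv.
by split=> _; [exists (PMain v psi Q) => //; apply/mP|move=> q /mP ->].
Qed.

(** X is an exit of the body but not of [psi]; its positions remain a separate target, to be removed
    afterwards. From [N A] the single move enters [U_ A] by completeness for the body. *)
Lemma fix_region A : region (open_vars psi `|` Xpos) (U_ A `|` N A).
Proof.
have [[R I H] C] := HU A; apply: region_step.
  apply: region_weaken R => _ [v [Y [Q [-> fY]]]].
  have [->|nYX] := eqVneq Y X; first by right; exists v, Q.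
  by left; exists v, Y, Q; rewrite /= eq_sym nYX.
move=> _ [v [Q [-> l FAv]]] _.
have hv : holds (update V X (signed c A)) p v Q by rewrite /holds (fix_role l).
have [fv|nfv] := pselect (fallible v).
  exact: controls_fallible (holds_fallible fv hv).
have mv : moves phi (PMain v psi Q) (PMain v p Q) by [].
have Up : U_ A (PMain v p Q) by apply: C => //; apply: legal_moves l mv.
by split=> _; [exists (PMain v p Q)|move=> _ [_ ->]].
Qed.

Lemma fix_inside A r : (U_ A `|` N A) r -> is_position psi r /\ legal r.
Proof.
have [[_ I _] _] := HU A; case=> [/I[Ir lr]|[v [Q [-> l _]]]]; split=> //.
  by apply: is_position_sub Ir; right; apply: occ_subformula (occ_refl p).
by left.
Qed.

Lemma fix_vars A v Y Q : (U_ A `|` N A) (PMain v (FVar Y) Q) -> free Y psi ->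
  holds V (FVar Y) v Q.
Proof.
have [[_ _ H] _] := HU A; case=> [UY|[? [? []//]]] /= /andP[nXY fY].
by have := H _ _ _ UY fY; rewrite /holds /= eq_sym (negbTE nXY).
Qed.

Lemma fix_main A v Q : legal (PMain v psi Q) -> F A v ->
  (U_ A `|` N A) (PMain v psi Q).
Proof. by move=> l FA; right; exists v, Q. Qed.

Lemma holds_fix v Q : legal (PMain v psi Q) ->
  holds V psi v Q = signed c (sem V psi) v.
Proof. by move=> l; rewrite /holds (fix_role l). Qed.

Lemma fix_unfold : F (signed c (sem V psi)) = signed c (sem V psi).
Proof.
rewrite /F signedK; congr signed; rewrite /psi; case: (e) (hwf sub_psi) => pos.
  exact: (@sem_mu _ _ M V X p pos).1.
exact: (@sem_nu _ _ M V X p pos).1.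
Qed.

(** For [pl] an unfavourable fixed point is always a least one: [Mu] seen by the Verifier, or [Nu]
    seen by the Refuter, where complementation turns the greatest fixed point into the least one of
    the dual operator. *)
Lemma fix_least : ~~ favours pl e b ->
  forall A, F A `<=` A -> signed c (sem V psi) `<=` A.
Proof.
rewrite /favours -/c /psi => fav A FA v; move: FA; rewrite /F /signed.
case: (e) fav; case: (c) => //= _ FA.
  by case=> [fv|]; [apply: FA; apply: sem_fallible|apply].
move=> nv; apply: contrapT => nA; apply: nv; right; exists (~` A) => // u nAu.
by apply: contrapT => nF; apply: nAu; apply: FA.
Qed.

Lemma solved_fix_favourable : favours pl e b ->
  exists U, sound V psi U /\ complete V psi U.
Proof.
move=> fav; pose S := signed c (sem V psi).
exists (U_ S `|` N S); split; last first.
  by move=> v Q l; rewrite (holds_fix l) => Sv; apply: fix_main => //; rewrite fix_unfold.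
split; [|exact: fix_inside|exact: fix_vars].
have XU v Q : (U_ S `|` N S) (PMain v (FVar X) Q) -> U_ S (PMain v (FVar X) Q).
  by case=> // -[? [? []]].
apply: (region_recur (fix_region S)).
  move=> r UX [v [Q E]] _; move: UX; rewrite E => /XU UX.
  apply: (fix_var_controls UX) => l Sv.
  by apply: fix_main => //; rewrite fix_unfold.
move=> r Hr inf; exists e, X, p, b; split=> //; split.
  move=> n; have [i ni [v [Q E]]] := inf n; exists i => //.
  exists v, X, Q; split=> //; have [] := Hr i; rewrite E => /XU UX m.
  have [sX _ _] := fix_var_position UX.
  by case: (m) => nfv _; apply/(fix_var_moves Q _ sX nfv).
(* The play stays in positions of [psi], so any formula regenerated in it is a subformula of
   [psi]. *)
move=> theta /(_ 0)[i _ [v [Y [Q [_ E]]]]].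
by have [+ _] := Hr i.+1; rewrite E => /fix_inside[].
Qed.

Lemma solved_fix_unfavourable : ~~ favours pl e b ->
  exists U, sound V psi U /\ complete V psi U.
Proof.
move=> fav; have mF := fix_operator_monotone.
exists [set r | exists2 A, range (approx F) A & (U_ A `|` N A) r]; split; last first.
  move=> v Q l; rewrite (holds_fix l) => /(approx_cover mF (fix_least fav))[t Ft].
  by exists (approx F t); [exists t|apply: fix_main].
split.
(* The indices are the approximants themselves under strict inclusion: comparability up to equality
   is required, whereas trees are only preordered. *)
- apply: (region_glue set0 (wf_approx mF) _ _ (T_ := fun=> open_vars psi `|` Xpos)).
  + move=> A B C [? _ [AB nBA]] [_ ? [BC nCB]]; split=> //; split.
      exact: subset_trans BC.
    by move=> CA; apply: nCB; apply: subset_trans CA AB.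
  + move=> _ _ [s _ <-] [t _ <-].
    have [st|nst] := pselect (approx F s `<=` approx F t); last first.
      apply: Or33; split; [by exists t|by exists s|split=> //].
      by case: (approx_total mF s t).
    have [ts|nts] := pselect (approx F t `<=` approx F s).
      by apply: Or31; apply/seteqP.
    by apply: Or32; split; [exists s|exists t|].
  + by move=> A _; apply: fix_region.
  + move=> _ r [t _ <-] Ur [//|[v [Q E]]] _; move: Ur; rewrite E.
    case=> [UX|[? [? []//]]].
    (* Each regeneration passes to a strictly smaller approximant [s] for which [v] already lies in
       F of it. *)
    apply: (fix_var_controls UX) => l /(approx_lt mF)[s [lt Fs]].
    exists (approx F s); last exact: fix_main.
    by split; [exists s|split].
- by move=> r [A _ /fix_inside].
- by move=> v Y Q [A _ /fix_vars].
Qed.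

End FixedPoint.

Lemma solvable_fix e X p : subformula (FFix e X p) phi -> solvable p ->
  solvable (FFix e X p).
Proof.
move=> /subformula_occ[b ob] IH V VP.
have /choice[U_ HU] : forall A, exists U,
    sound (update V X (signed (verifies pl b) A)) p U /\
    complete (update V X (signed (verifies pl b) A)) p U.
  by move=> A; apply: IH.
by case: (boolP (favours pl e b)) => fav;
  [apply: solved_fix_favourable HU fav|apply: solved_fix_unfavourable HU fav].
Qed.

Lemma solvable_sub psi : subformula psi phi -> solvable psi.
Proof.
elim: psi => [P|X|||p IHp|p IHp q IHq|p IHp q IHq|p IHp q IHq
  |p IHp|p IHp|e X p IHp] sub.
- exact: solvable_prop.
- exact: solvable_var.
- exact: solvable_bot.
- exact: solvable_top.
all: have sp := occ_subformula (occ_refl p).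
all: have {}IHp : solvable p by apply: IHp; apply: subformula_trans sub; right; auto.
all: try (have {}IHq : solvable q by apply: IHq; apply: subformula_trans sub;
  right; right; apply: occ_subformula (occ_refl q)).
- exact: solvable_neg.
- exact: solvable_and.
- exact: solvable_or.
- exact: solvable_imp.
- exact: solvable_box.
- exact: solvable_dia.
- exact: solvable_fix.
Qed.

End Regions.

(** * From regions to winning strategies, and determinacy *)

Lemma reachable_legal w (p : pos) : reachable w phi p -> legal p.
Proof.
by elim=> [|{}p q _ lp mq]; [exact: occ_refl|exact: legal_moves mq].
Qed.

Lemma run_reachable w (r : nat -> pos) n : r 0 = initial w phi ->
  (forall i, i < n -> moves phi (r i) (r i.+1)) ->
  forall i, i <= n -> reachable w phi (r i).
Proof.
move=> r0 mr; elim=> [_|i IH lt]; first by rewrite r0; constructor.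
by apply: reachable_move (mr i lt); apply: IH; lia.
Qed.

(** Variables free in [phi] itself act as proposition symbols: the play ends there, and a favourable
    value makes the opponent the owner. *)
Lemma open_vars_stuck pl v X Q : free X phi ->
  holds pl (@valn _ _ M) (FVar X) v Q ->
  ~ owns phi pl (PMain v (FVar X) Q) /\ forall q, ~ moves phi (PMain v (FVar X) Q) q.
Proof.
move=> fX hX; split=> [/ownsE|q [_ [+ _]]]; last by rewrite fX.
move: hX; rewrite /holds /signed /= fX /=.
case: (pselect (fallible v)) => fv.
  by rewrite (asboolT fv); case: ifP => // _ []; left.
rewrite (asboolF fv); case: (pselect (valn (inr X) v)) => vX.
  by rewrite (asboolT vX); case: ifP => // _ []; right.
by rewrite (asboolF vX); case: ifP => // _ [].
Qed.

(** By uniqueness of binders, all reachable positions at the outermost formula carry the role of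
    parity [b], so ownership by parity agrees with ownership by reachability. *)
Lemma won_wins pl w (r : nat -> pos) : infinite_run w phi r -> won phi pl r ->
  wins_infinite w phi pl r.
Proof.
move=> [r0 mr] [e [X [p [b [out ob fav]]]]]; exists (FFix e X p) => //.
have [i _ [v [Y [Q [_ E]]]]] := out.1 0.
have re : reachable w phi (PMain v (FFix e X p) Q).
  by rewrite -E; apply: (@run_reachable _ _ i.+1) => // *; apply: mr.
have roleE u Q' : reachable w phi (PMain u (FFix e X p) Q') -> is_verifier Q' = b.
  by move=> /reachable_legal l; have [] := fix_unique hwb l ob.
case: pl fav; rewrite /favours /verifies.
  move=> fav; exists e, X, p, v, Q; split=> //.
  by move: fav; rewrite -(roleE _ _ re); case: (Q); case: (e).
move=> fav [e' [X' [p' [u [Q' [[Ee _ _] re' EQ]]]]]].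
by move: fav; rewrite -(roleE _ _ re') EQ -Ee; case: (e).
Qed.

Lemma sat_wins pl w : holds pl (@valn _ _ M) phi w Verifier ->
  has_winning_strategy w phi pl.
Proof.
move=> hw.
have [U [[[s [H1 H2]] I H] C]] :=
  @solvable_sub pl phi (occ_subformula (occ_refl phi)) (@valn _ _ M) (fun=> erefl).
have U0 : U (initial w phi) by apply: C hw; apply: occ_refl.
have stuck p : U p -> open_vars phi p -> ~ owns phi pl p /\ forall q, ~ moves phi p q.
  move=> Up [v [X [Q [E fX]]]]; move: Up; rewrite E => UX.
  by apply: open_vars_stuck => //; apply: H.
have /choice[d Hd] : forall p : pos, exists q, moves phi p !=set0 -> moves phi p q.
  move=> p; have [[q mq]|n] := pselect (moves phi p !=set0); first by exists q.
  by exists p.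
(* A strategy must give a legitimate move at every owned position that has one; outside the region
   any available move [d p] serves. *)
pose sigma p := if pselect (U p /\ ~ open_vars phi p) then s p else d p.
have stay p q : U p -> moves phi p q -> (owns phi pl p -> q = sigma p) -> 
    [/\ U q, ~ open_vars phi p & owns phi pl p -> q = s p].
  move=> Up mq fq.
  have nT : ~ open_vars phi p by move=> /(stuck _ Up)[_ /(_ q)].
  have fq' : owns phi pl p -> q = s p.
    by move=> /fq; rewrite /sigma; case: pselect => // -[].
  split=> //; have [c1 c2] := H1 _ Up nT.
  have [op|nop] := pselect (owns phi pl p); last exact: (c2 nop _ mq).
  by rewrite (fq' op); have [] := c1 op.
have stayn r n : r 0 = initial w phi -> (forall i, i < n -> moves phi (r i) (r i.+1)) ->
    (forall i, i < n -> follows_at phi pl sigma r i) -> forall i, i <= n -> U (r i).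
  move=> r0 mr fr; elim=> [|i IH] lt; first by rewrite r0.
  by have [] := stay (r i) (r i.+1) (IH (ltnW lt)) (mr i lt) (fr i lt).
exists sigma.
  move=> p _ op mp; rewrite /sigma; case: pselect => [[Up nT]|?]; last exact: Hd.
  by have [/(_ op)[]] := H1 _ Up nT.
split=> [r n [r0 mr m0] fr|r [r0 mr] fr].
  have Un := stayn r n r0 mr fr n (leqnn n); move=> on.
  have [/(stuck _ Un)[]//|nT] := pselect (open_vars phi (r n)).
  have [/(_ on)[+ _] _] := H1 _ Un nT.
  by rewrite m0.
have Ui i : U (r i) by exact: (stayn r i r0).
apply: won_wins => //; apply: H2 => i.
by have [_ nT fs] := stay _ _ (Ui i) (mr i) (fr i); split.
Qed.

(** Playing the two strategies against each other yields one run that follows both, and both players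
    would win it. *)
Lemma winning_exclusive (w : M) : has_winning_strategy w phi PlayerI ->
  has_winning_strategy w phi PlayerII -> False.
Proof.
move=> [s1 st1 [fin1 inf1]] [s2 st2 [fin2 inf2]].
have dich p : owns phi PlayerII p <-> ~ owns phi PlayerI p.
  by rewrite /owns; case: (owner_role phi p); case: p => > /=;
    match goal with Q : role |- _ => case: Q end; split.
pose next p := if pselect (owns phi PlayerI p) then s1 p else s2 p.
pose r i := iter i next (initial w phi).
have f1 i : follows_at phi PlayerI s1 r i.
  by rewrite /follows_at /r /= /next => o; case: pselect.
have f2 i : follows_at phi PlayerII s2 r i.
  by rewrite /follows_at /r /= /next => /dich o; case: pselect.
have step i : reachable w phi (r i) -> moves phi (r i) !=set0 ->
    moves phi (r i) (r i.+1).
  move=> /reachable_legal/legal_position ip ne; rewrite [r i.+1]/= -/(r i) /next.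
  by case: pselect => o; [apply: st1|apply: st2 => //; apply/dich].
have reach n : (forall i, i < n -> moves phi (r i) !=set0) ->
    forall i, i <= n -> reachable w phi (r i).
  move=> ne; elim=> [_|i IH lt]; first exact: reachable_initial.
  have ri := IH (ltnW lt); exact: reachable_move ri (step i ri (ne i lt)).
have [stop|go] := pselect (exists n, `[< moves phi (r n) = set0 >]).
  case: (ex_minnP stop) => n /asboolP m0 min.
  have ne i : i < n -> moves phi (r i) !=set0.
    move=> lt; apply/set0P/negP => /eqP m1.
    by have := min i (asboolT m1); rewrite leqNgt lt.
  have run : finite_run w phi r n.
    by split=> // i lt; apply: step (ne i lt); apply: (reach n ne); apply: ltnW.
  by apply: (fin2 _ _ run (fun i _ => f2 i)); apply/dich; apply: fin1 run _.
have ne i : moves phi (r i) !=set0.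
  by apply/set0P/negP => /eqP m1; apply: go; exists i; apply/asboolT.
have run : infinite_run w phi r.
  by split=> // i; apply: step => //; apply: (reach i).
have [t1 [i1 o1] w1] := inf1 _ run f1; have [t2 [i2 o2] w2] := inf2 _ run f2.
(* The two outermost regenerated formulas are subformulas of each other, hence equal, and player II
   owns only what player I does not. *)
by case: w2; rewrite (subformula_antisym (o1 _ i2) (o2 _ i1)).
Qed.

End Adequacy.

Theorem mainTheorem1 (PS : Type) (VS : eqType) (M : ckModel PS VS) (w : M)
    (phi : formula PS VS) (hwf : well_formed phi) (hwn : well_named phi) :
  (has_winning_strategy w phi PlayerI <-> satisfies w phi) /\
  (has_winning_strategy w phi PlayerII <-> ~ satisfies w phi).
Proof.
have [_ hwb] := hwn.
have sat1 : satisfies w phi -> has_winning_strategy w phi PlayerI.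
  exact: (@sat_wins _ _ M phi hwf hwb PlayerI w).
have sat2 : ~ satisfies w phi -> has_winning_strategy w phi PlayerII.
  exact: (@sat_wins _ _ M phi hwf hwb PlayerII w).
have excl := @winning_exclusive _ _ M phi hwf hwb w.
split; split=> //.
  by move=> w1; apply: contrapT => /sat2; apply: excl.
by move=> w2 /sat1 w1; apply: excl.
Qed.
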